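(* Let $X,U$ be Banach spaces and $\mathcal{U}=PC(\mathbb{R}_+,U)$. Let $\{A(t)\}_{t\ge0}$ generate a strongly continuous evolution family $\{W(t,s)\}_{t\ge s\ge0}$. Let $B\in C(\mathbb{R}_+,L(U,X))$ with $\sup_t\|B(t)\|<\infty$, and consider $$\dot x=A(t)x+B(t)u+\psi(t,x,u),\quad x(t_0)=x_0. \tag{N}$$ Assume: - $\Psi(t,x,u)=B(t)u+\psi(t,x,u)$ satisfies $(\mathcal{H}_1)$; - there exist $\gamma>0$ and $\delta\in\mathcal{K}$ such that $\|\psi(t,x,v)\|_X\le\gamma\|x\|_X\delta(\|v\|_U)$ for all $t\ge0$, $x\in X$ and $v\in U$; - $\{W(t,s)\}$ is uniformly exponentially stable; - there exist $M,\lambda>0$ with $\|W(t,s)x\|_X\ge Me^{-\lambda(t-s)}\|x\|_X$ for all $x\in X$ and $t\ge s\ge0$. Let $V(t,x)=\int_t^\infty\|W(\tau,t)x\|_X^2d\tau$. Then $Z(t,x)=\ln(1+V(t,x))$ is a coercive iISS Lyapunov function for (N), and (N) is iISS.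
   Context: A strongly continuous evolution family generated by $\{A(t)\}$ satisfies: - $W(s,s)=I$ and $W(t,s)=W(t,r)W(r,s)$; - strong continuity in $(t,s)$; - for $v\in D(A(s))$: $\partial_tW(t,s)v=A(t)W(t,s)v$ and $\partial_sW(t,s)v=-W(t,s)A(s)v$. Uniform exponential stability means $\|W(t,s)\|\le ke^{-w(t-s)}$ for some $k,w>0$. $PC(\mathbb{R}_+,U)$ consists of bounded, right-continuous, piecewise continuous functions. $(\mathcal{H}_1)$: $\Psi$ is jointly continuous in $(t,u)$ and Lipschitz in $x$ on bounded sets (uniformly on bounded time intervals). Solutions are the mild solutions $\phi$ of $x(t)=W(t,t_0)x_0+\int_{t_0}^tW(t,s)\Psi(s,x(s),u(s))ds$. Lie derivative: $\dot Z_u(t,x)=\limsup_{h\to0^+}\frac1h(Z(t+h,\phi(t+h,t,x,u))-Z(t,x))$. Coercive iISS Lyapunov function. A continuous $Z$ with $Z(t,0)=0$, $\alpha_1(\|x\|)\le Z(t,x)\le\alpha_2(\|x\|)$ for some $\alpha_1,\alpha_2\in\mathcal{K}_\infty$, and $\dot Z_u(t,x)\le-\eta(\|x\|)+\chi(\|u(t)\|_U)$ for all $t,x,u$, with $\eta$ continuous positive definite and $\chi\in\mathcal{K}$. iISS: the system is forward complete and there exist $\alpha\in\mathcal{K}_\infty$, $\mu\in\mathcal{K}$ and $\beta\in\mathcal{KL}$ with $$\|\phi(t,t_0,x_0,u)\|\le\beta(\|x_0\|,t-t_0)+\alpha\Big(\int_{t_0}^t\mu(\|u(s)\|_U)ds\Big)\quad\text{for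 all } t\ge t_0\ge0.$$ *)

(* Defs.v *)
From HB Require Import structures.
From mathcomp Require Import all_boot all_order all_algebra.
From mathcomp Require Import all_classical all_reals all_analysis.
Set Implicit Arguments. Unset Strict Implicit. Unset Printing Implicit Defensive.
Import Order.TTheory GRing.Theory Num.Theory numFieldNormedType.Exports.
Local Open Scope classical_set_scope.
Local Open Scope ring_scope.

Section Defs.
Variable R : realType.

Definition class_K (g : R -> R) : Prop :=
  {within [set r : R | 0 <= r], continuous g} /\ g 0 = 0 /\
  (forall a b : R, 0 <= a -> a < b -> g a < g b).

Definition class_Kinf (g : R -> R) : Prop :=
  class_K g /\ (forall M : R, exists r : R, 0 <= r /\ M <= g r).

Definition class_KL (b : R -> R -> R) : Prop :=
  (forall t : R, 0 <= t -> class_K (fun r => b r t)) /\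
  (forall r : R, 0 <= r ->
     (forall s t : R, 0 <= s -> s <= t -> b r t <= b r s) /\
     ((fun t => b r t) @ +oo --> (0 : R))).

Definition pos_def (eta : R -> R) : Prop :=
  {within [set r : R | 0 <= r], continuous eta} /\ eta 0 = 0 /\
  (forall r : R, 0 < r -> 0 < eta r).

Variables X U : completeNormedModType R.

Definition PC (u : R -> U) : Prop :=
  (exists c : R, forall t : R, 0 <= t -> `|u t| <= c) /\
  (forall t : R, 0 <= t -> u @ t^'+ --> u t) /\
  (forall T : R, exists S : seq R,
      forall t : R, 0 < t <= T -> t \notin S -> {for t, continuous u}) /\
  (forall t : R, 0 < t -> exists l : U, u @ t^'- --> l).

Definition tagged_partition (a b : R) (n : nat) (p xi : nat -> R) : Prop :=
  p 0%N = a /\ p n = b /\ (forall i : nat, (i < n)%N -> p i <= xi i <= p i.+1).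

Definition riemann_sum (f : R -> X) (n : nat) (p xi : nat -> R) : X :=
  \sum_(i < n) (p i.+1 - p i) *: f (xi i).

Definition is_RInt (f : R -> X) (a b : R) (I : X) : Prop :=
  forall e : R, 0 < e -> exists d : R, 0 < d /\
    forall (n : nat) (p xi : nat -> R), tagged_partition a b n p xi ->
      (forall i : nat, (i < n)%N -> p i.+1 - p i < d) ->
      `|riemann_sum f n p xi - I| < e.

Definition lin_operator (D : set X) (A : X -> X) : Prop :=
  D 0 /\ (forall (a : R) (x y : X), D x -> D y -> D (a *: x + y)) /\
  (forall (a : R) (x y : X), D x -> D y -> A (a *: x + y) = a *: A x + A y).

Definition evolution_family_gen (DA : R -> set X) (A : R -> X -> X)
    (W : R -> R -> {linear X -> X}) : Prop :=
  (forall t : R, 0 <= t -> lin_operator (DA t) (A t)) /\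
  (forall t s : R, 0 <= s <= t -> exists c : R, forall x : X, `|W t s x| <= c * `|x|) /\
  (forall s : R, 0 <= s -> forall x : X, W s s x = x) /\
  (forall t r s : R, 0 <= s <= r -> r <= t -> forall x : X, W t s x = W t r (W r s x)) /\
  (forall x : X, {within [set q : R * R | 0 <= q.2 <= q.1],
                    continuous (fun q : R * R => W q.1 q.2 x)}) /\
  (forall t s : R, 0 <= s <= t -> forall v : X, DA s v ->
     DA t (W t s v) /\
     (fun h : R => h^-1 *: (W (t + h) s v - W t s v))
        @ within (fun h : R => s <= t + h) 0^' --> A t (W t s v)) /\
  (forall t s : R, 0 <= s <= t -> forall v : X, DA s v ->
     (fun h : R => h^-1 *: (W t (s + h) v - W t s v))
        @ within (fun h : R => 0 <= s + h <= t) 0^' --> - W t s (A s v)).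

Definition H1 (Psi : R -> X -> U -> X) : Prop :=
  (forall x : X, {within [set q : R * U | 0 <= q.1],
                    continuous (fun q : R * U => Psi q.1 x q.2)}) /\
  (forall C T : R, 0 < C -> 0 < T -> exists L : R, 0 < L /\
     forall (t : R) (x y : X) (v : U), 0 <= t <= T ->
       `|x| <= C -> `|y| <= C -> `|v| <= C ->
       `|Psi t x v - Psi t y v| <= L * `|x - y|).

Definition mild_sol (W : R -> R -> {linear X -> X}) (Psi : R -> X -> U -> X)
    (t0 : R) (x0 : X) (u : R -> U) (T : \bar R) (phi : R -> X) : Prop :=
  {within [set t : R | t0 <= t /\ (t%:E < T)%E], continuous phi} /\
  (forall t : R, t0 <= t -> (t%:E < T)%E ->
     is_RInt (fun s => W t s (Psi s (phi s) (u s))) t0 t (phi t - W t t0 x0)).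

(* upper right Dini derivative of Z along the solution phi starting at (t,x) *)
Definition lie_deriv (Z : R -> X -> R) (t : R) (x : X) (phi : R -> X) : \bar R :=
  limf_esup (fun h : R => ((h^-1 * (Z (t + h) (phi (t + h)) - Z t x))%:E)) 0^'+.

Definition coercive_iISS_LF (W : R -> R -> {linear X -> X})
    (Psi : R -> X -> U -> X) (Z : R -> X -> R) : Prop :=
  {within [set q : R * X | 0 <= q.1], continuous (fun q : R * X => Z q.1 q.2)} /\
  (forall t : R, 0 <= t -> Z t 0 = 0) /\
  (exists a1 a2 : R -> R, class_Kinf a1 /\ class_Kinf a2 /\
     forall (t : R) (x : X), 0 <= t -> a1 `|x| <= Z t x <= a2 `|x|) /\
  (exists (eta chi : R -> R), pos_def eta /\ class_K chi /\
     forall (t : R) (x : X) (u : R -> U) (T : \bar R) (phi : R -> X),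
       0 <= t -> (t%:E < T)%E -> PC u -> mild_sol W Psi t x u T phi ->
       (lie_deriv Z t x phi <= (- eta `|x| + chi `|u t|)%:E)%E).

Definition forward_complete (W : R -> R -> {linear X -> X})
    (Psi : R -> X -> U -> X) : Prop :=
  forall (t0 : R) (x0 : X) (u : R -> U), 0 <= t0 -> PC u ->
    exists phi : R -> X, mild_sol W Psi t0 x0 u +oo%E phi.

Definition iISS (W : R -> R -> {linear X -> X}) (Psi : R -> X -> U -> X) : Prop :=
  forward_complete W Psi /\
  exists (alpha mu : R -> R) (beta : R -> R -> R),
    class_Kinf alpha /\ class_K mu /\ class_KL beta /\
    forall (t0 : R) (x0 : X) (u : R -> U) (phi : R -> X),
      0 <= t0 -> PC u -> mild_sol W Psi t0 x0 u +oo%E phi ->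
      forall t : R, t0 <= t ->
        `|phi t| <= beta `|x0| (t - t0) +
          alpha (\int[@lebesgue_measure R]_(s in `[t0, t]) mu `|u s|).

Definition Vfun (W : R -> R -> {linear X -> X}) (t : R) (x : X) : R :=
  \int[@lebesgue_measure R]_(tau in `[t, +oo[) (`|W tau t x| ^+ 2).

End Defs.

(* Main.v *)
(* Along a mild solution, V(t+h, phi(t+h)) - V(t,x) splits into the decrease of V
   along the free motion W(.,t)x, which is the integral of |W(tau,t)x|^2 over
   [t,t+h], and the effect of the input, of size O(h |Psi(t,x,u(t))|) because V(t,.)
   is locally Lipschitz.  The logarithm absorbs the bilinear term
   |x|^2 delta(|u|), as |x|^2 <= K (1 + V(t,x)).

   The iISS estimate does not need a comparison theorem for Dini derivatives: in
   the variation of constants formula the bilinear growth of Psi and Gronwall's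
   lemma give |phi(t)| <= (k e^{-w(t-t0)} |x0| + k b E) e^{2 k gamma E} with
   E the integral of |u| + delta(|u|), and a e^z <= a + a^2/2 + (e^z - 1)^2/2
   separates x0 from u.  The same linear growth keeps all Picard iterates below one
   exponential, so that they converge on the whole half-line. *)

Require Import Defs.
From HB Require Import structures.
From mathcomp Require Import all_boot all_order all_algebra.
From mathcomp Require Import ring lra.
From mathcomp Require Import all_classical all_reals all_analysis measurable_realfun.
Import Order.TTheory GRing.Theory Num.Theory numFieldNormedType.Exports.
Local Open Scope classical_set_scope.
Local Open Scope ring_scope.
Set Implicit Arguments.
Unset Strict Implicit.
Unset Printing Implicit Defensive.

(** * Riemann integration of functions with values in a Banach space *)

Section RiemannIntegral.
Context {R : realType} {X : completeNormedModType R}.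
Implicit Types (f g : R -> X) (a b c d e : R) (p xi : nat -> R).

(** Two integrals coexist: the variation of constants formula is stated with Riemann sums in [X],
    whereas [V] and the input energy are Lebesgue integrals of real functions. They meet in one
    estimate only, which bounds the norm of a Riemann integral by the Lebesgue integral of a
    majorant. A mild solution need not be differentiable nor stay in the domains of [A t], so
    nothing is differentiated along it: increments over [t, t+h] are bounded first, and only the
    final quotient is passed to the limsup. The lower bound on [W] acts twice. It gives V >= c1
    |x|^2, hence coercivity, and through this it lets 1 + V absorb both |x| and |x|^2. The upper
    constant c2 = k^2 / (2w) yields the decay rate r^2 / (1 + c2 r^2), which is bounded in r. Since
    [Psi] is Lipschitz in x on bounded sets only, Picard iterates must be confined before they can
    be compared. The confining exponential gives a Lipschitz constant on each compact interval, and
    an exponentially weighted norm turns it into a contraction on the whole of that interval,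
    without continuation step by step. *)

Lemma tagged_partition_step a b n p xi : tagged_partition a b n p xi ->
  forall i, (i < n)%N -> p i <= p i.+1.
Proof. by move=> [_ [_ h]] i /h /andP[h1 h2]; exact: le_trans h1 h2. Qed.

Lemma tagged_partition_ge a b n p xi : tagged_partition a b n p xi ->
  forall i, (i <= n)%N -> a <= p i.
Proof.
move=> tp; elim=> [_|i IH lin]; first by case: tp => ->.
exact: le_trans (IH (ltnW lin)) (tagged_partition_step tp lin).
Qed.

Lemma tagged_partition_le a b n p xi : tagged_partition a b n p xi ->
  forall i, (i <= n)%N -> p i <= b.
Proof.
move=> tp i lein; case: (tp) => _ [<- _].
have: forall k, (i + k <= n)%N -> p i <= p (i + k)%N.
  elim=> [|k IH]; first by rewrite addn0.
  rewrite addnS => h; apply: le_trans (IH (ltnW h)) _.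
  exact: tagged_partition_step tp _ h.
by move=> /(_ (n - i)%N); rewrite subnKC //; apply.
Qed.

Lemma tagged_partition_tag a b n p xi : tagged_partition a b n p xi ->
  forall i, (i < n)%N -> a <= xi i <= b.
Proof.
move=> tp i lin; case: (tp) => _ [_ /(_ i lin)/andP[h1 h2]].
rewrite (le_trans (tagged_partition_ge tp (ltnW lin)) h1).
exact: le_trans h2 (tagged_partition_le tp lin).
Qed.

Lemma fine_partition a b d : a <= b -> 0 < d ->
  exists (n : nat) (p : nat -> R), p 0%N = a /\ p n = b /\
    (forall i, (i < n)%N -> p i <= p i.+1 /\ p i.+1 - p i < d).
Proof.
move=> ab d0; pose N := (Num.bound ((b - a) / d)).
have hN : (b - a) / d < N.+1%:R.
  apply: lt_trans (archi_boundP _) _; first by rewrite divr_ge0 ?subr_ge0 // ltW.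
  by rewrite ltr_nat.
have N0 : 0 < N.+1%:R :> R by [].
exists N.+1, (fun i => a + (b - a) * i%:R / N.+1%:R); split; first by rewrite mulr0 mul0r addr0.
split; first by rewrite mulfK ?gt_eqF // addrC subrK.
move=> i _ /=; have -> : (b - a) * i.+1%:R / N.+1%:R =
   (b - a) * i%:R / N.+1%:R + (b - a) / N.+1%:R.
  by rewrite -[i.+1]addn1 natrD mulrDr mulr1 mulrDl.
have h0 : 0 <= (b - a) / N.+1%:R by rewrite divr_ge0 ?subr_ge0.
have : (b - a) / N.+1%:R < d by rewrite ltr_pdivrMr // mulrC -ltr_pdivrMr.
move: h0; move: (_ / _) ((b - a) * _ / _) => y x h0 hy.
by split; lra.
Qed.

(** The predicate [P] sees both ends of its cell, so tags can be adapted to the partition after it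
    is fixed; a trivial [P] leaves the mere existence of fine tagged partitions. *)
Lemma fine_tagged_partition a b d (P : R -> R -> R -> Prop) : a <= b -> 0 < d ->
  (forall p q : R, a <= p -> p <= q -> q <= b -> exists xi : R, p <= xi <= q /\ P p q xi) ->
  exists n p xi, tagged_partition a b n p xi /\
    (forall i, (i < n)%N -> p i.+1 - p i < d) /\
    (forall i, (i < n)%N -> P (p i) (p i.+1) (xi i)).
Proof.
move=> ab d0 HP; have [n [p [p0 [pn hp]]]] := fine_partition ab d0.
have tp0 : tagged_partition a b n p p.
  by split=> //; split=> // i /hp[-> _]; rewrite lexx.
have /choice[xi hxi] : forall i : nat, exists x : R, (i < n)%N ->
    p i <= x <= p i.+1 /\ P (p i) (p i.+1) x.
  move=> i; case: (boolP (i < n)%N) => [lin|_]; last by exists 0.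
  have [||x hx] := HP (p i) (p i.+1) _ (hp _ lin).1.
  - exact: tagged_partition_ge tp0 _ (ltnW lin).
  - exact: tagged_partition_le tp0 _ lin.
  by exists x.
exists n, p, xi; split; first by split=> //; split=> // i /hxi[].
by split=> i lin; [case: (hp i lin)|case: (hxi i lin)].
Qed.

(* The tags of the Riemann sums are free, so it is enough to find in every cell
   one good tag. *)
Lemma is_RInt_norm_le f a b I (G : R -> R) : a <= b -> is_RInt f a b I ->
  (forall (p q : R) e, a <= p -> p <= q -> q <= b -> 0 < e ->
     exists xi : R, p <= xi <= q /\ (q - p) * `|f xi| <= G q - G p + e * (q - p)) ->
  `|I| <= G b - G a.
Proof.
move=> ab HI HG; apply/ler_addgt0Pr => e e0.
(* One [e1] pays for the distance from the Riemann sum to [I], and [e1 * (b - a)] for the slack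
   summed over the cells; the [1 +] covers the case a = b. *)
pose e1 := e / (1 + (b - a)).
have ba1 : 0 < 1 + (b - a) by rewrite ltr_wpDr // subr_ge0.
have e10 : 0 < e1 by rewrite divr_gt0.
have ee1 : e = e1 + e1 * (b - a) by rewrite -[X in X + _]mulr1 -mulrDr divfK ?gt_eqF.
have [d [d0 Hd]] := HI _ e10.
have [|n [p [xi [tp [hm hP]]]]] := @fine_tagged_partition a b d
   (fun p q xi : R => (q - p) * `|f xi| <= G q - G p + e1 * (q - p)) ab d0.
  by move=> p q ap pq qb; apply: HG.
have := Hd n p xi tp hm.
have : `|riemann_sum f n p xi| <= G b - G a + e1 * (b - a).
  case: (tp) => p0 [pn _]; rewrite -pn -p0 /riemann_sum.
  suff key j : (j <= n)%N -> `|\sum_(i < j) (p i.+1 - p i) *: f (xi i)| <=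
      G (p j) - G (p 0%N) + e1 * (p j - p 0%N) by exact: key.
  elim: j => [_|j IH lin]; first by rewrite big_ord0 normr0 !subrr mulr0 addr0.
  rewrite big_ord_recr /=; apply: le_trans (ler_normD _ _) _.
  have h1 := IH (ltnW lin); have h2 := hP j lin.
  rewrite normrZ ger0_norm ?subr_ge0 ?(tagged_partition_step tp) //.
  rewrite !mulrBr in h1 h2 *; lra.
set S := riemann_sum _ _ _ _ => h1 h2.
have : `|I| <= `|S| + `|S - I|.
  by rewrite -{1}[I](subKr S); exact: ler_normB.
lra.
Qed.

Lemma is_RInt_norm_le_cst f a b I N : a <= b -> is_RInt f a b I ->
  (forall s, a <= s <= b -> `|f s| <= N) -> `|I| <= N * (b - a).
Proof.
move=> ab HI HN; rewrite mulrBr.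
apply: (is_RInt_norm_le (G := fun x => N * x) ab HI) => p q e ap pq qb e0.
exists p; split; first by rewrite lexx.
have := HN p; rewrite ap (le_trans pq qb) => /(_ isT) h.
have : (q - p) * `|f p| <= (q - p) * N by rewrite ler_wpM2l // subr_ge0.
have : 0 <= e * (q - p) by rewrite mulr_ge0 ?subr_ge0 // ltW.
rewrite !mulrBr !mulrBl; lra.
Qed.

Lemma riemann_sum_lin c f g n p xi :
  riemann_sum (fun s => f s + c *: g s) n p xi =
  riemann_sum f n p xi + c *: riemann_sum g n p xi.
Proof.
rewrite /riemann_sum scaler_sumr -big_split /=; apply: eq_bigr => i _.
by rewrite scalerDr !scalerA mulrC.
Qed.

Lemma is_RInt_lin c f g a b I J : is_RInt f a b I -> is_RInt g a b J ->
  is_RInt (fun s => f s + c *: g s) a b (I + c *: J).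
Proof.
move=> HI HJ e e0; pose e1 := e / (1 + `|c|).
have c1 : 0 < 1 + `|c| by rewrite ltr_wpDr.
have e10 : 0 < e1 by rewrite divr_gt0.
have [d1 [d10 H1]] := HI _ e10; have [d2 [d20 H2]] := HJ _ e10.
exists (Num.min d1 d2); split; first by rewrite lt_min d10.
move=> n p xi tp hm.
have h1 : `|riemann_sum f n p xi - I| < e1.
  by apply: H1 => // i /hm; rewrite lt_min => /andP[].
have h2 : `|riemann_sum g n p xi - J| < e1.
  by apply: H2 => // i /hm; rewrite lt_min => /andP[].
rewrite riemann_sum_lin opprD addrACA -scalerBr.
apply: le_lt_trans (ler_normD _ _) _; rewrite normrZ.
have -> : e = e1 + `|c| * e1 by rewrite -[X in X + _]mul1r -mulrDl mulrC divfK ?gt_eqF.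
by apply: ltr_leD => //; rewrite ler_wpM2l // ltW.
Qed.

Lemma is_RInt_linear (L : {linear X -> X}) K f a b I :
  (forall x, `|L x| <= K * `|x|) ->
  is_RInt f a b I -> is_RInt (fun s => L (f s)) a b (L I).
Proof.
move=> HK HI e e0; pose e1 := e / (1 + `|K|).
have c1 : 0 < 1 + `|K| by rewrite ltr_wpDr.
have e10 : 0 < e1 by rewrite divr_gt0.
have [d [d0 Hd]] := HI _ e10; exists d; split=> // n p xi tp hm.
have -> : riemann_sum (fun s => L (f s)) n p xi = L (riemann_sum f n p xi).
  by rewrite /riemann_sum linear_sum; apply: eq_bigr => i _; rewrite linearZ.
rewrite -linearB; apply: le_lt_trans (HK _) _.
have h := Hd n p xi tp hm.
have -> : e = (1 + `|K|) * e1 by rewrite mulrC divfK ?gt_eqF.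
apply: (@le_lt_trans _ _ ((1 + `|K|) * `|riemann_sum f n p xi - I|)).
  by rewrite ler_wpM2r // (le_trans (ler_norm K)) // lerDr.
by rewrite ltr_pM2l.
Qed.

Lemma is_RInt_ext f g a b I : (forall s, a <= s <= b -> f s = g s) ->
  is_RInt f a b I -> is_RInt g a b I.
Proof.
move=> fg HI e e0; have [d [d0 Hd]] := HI _ e0; exists d; split=> // n p xi tp hm.
have <- : riemann_sum f n p xi = riemann_sum g n p xi; last exact: Hd.
apply: eq_bigr => i _; rewrite fg //; exact: tagged_partition_tag tp _ (ltn_ord i).
Qed.

Lemma is_RInt_unique f a b I J : a <= b ->
  is_RInt f a b I -> is_RInt f a b J -> I = J.
Proof.
move=> ab HI HJ; apply/eqP; rewrite -subr_eq0 -normr_le0.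
have := is_RInt_lin (-1) HI HJ; rewrite scaleN1r => H.
have := is_RInt_norm_le_cst (N := 0) ab H; rewrite mul0r; apply=> s _.
by rewrite scaleN1r subrr normr0.
Qed.

Lemma is_RInt_refl f a : is_RInt f a a 0.
Proof.
move=> e e0; exists 1; split=> // n p xi tp _; rewrite subr0.
rewrite /riemann_sum big1 ?normr0 // => i _.
have -> : p i.+1 = a.
  by apply/le_anti; rewrite (tagged_partition_le tp) // (tagged_partition_ge tp).
have -> : p i = a.
  apply/le_anti; rewrite (tagged_partition_le tp) ?(tagged_partition_ge tp) //;
  exact: ltnW.
by rewrite subrr scale0r.
Qed.

Lemma is_RInt_chasles f a b c I J K : a <= b -> b <= c ->
  is_RInt f a b I -> is_RInt f b c J -> is_RInt f a c K -> K = I + J.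
Proof.
move=> ab bc HI HJ HK; apply/eqP; rewrite -subr_eq0 -normr_le0.
apply/ler_addgt0Pr => e e0; rewrite add0r.
have e3 : 0 < e / 3 by lra.
have [d1 [d10 H1]] := HI _ e3; have [d2 [d20 H2]] := HJ _ e3.
have [d3 [d30 H3]] := HK _ e3.
pose d := Num.min d1 (Num.min d2 d3).
have d0 : 0 < d by rewrite !lt_min d10 d20.
have [|n [p [xi [tp [hm _]]]]] := @fine_tagged_partition a b d (fun _ _ _ => True) ab d0.
  by move=> p q _ pq _; exists p; rewrite lexx.
have [|m [q [eta [tq [hq _]]]]] := @fine_tagged_partition b c d (fun _ _ _ => True) bc d0.
  by move=> p' q _ pq _; exists p'; rewrite lexx.
have {H1} h1 : `|riemann_sum f n p xi - I| < e / 3.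
  by apply: H1 => // i /hm; rewrite !lt_min => /and3P[].
have {H2} h2 : `|riemann_sum f m q eta - J| < e / 3.
  by apply: H2 => // i /hq; rewrite !lt_min => /and3P[].
(* At the joint [p n = b = q 0], so the point of index [n] may come from either family, but the tag
   of index [n] already belongs to the second one: hence [<=] for points and [<] for tags. *)
pose r i := if (i <= n)%N then p i else q (i - n)%N.
pose zeta i := if (i < n)%N then xi i else eta (i - n)%N.
case: (tp) => p0 [pn hp]; case: (tq) => q0 [qm hq'].
have rl i : (i < n)%N -> r i = p i /\ r i.+1 = p i.+1 /\ zeta i = xi i.
  by move=> h; rewrite /r /zeta (ltnW h) h.
have rr i : r (n + i)%N = q i.
  rewrite /r; case: i => [|i]; first by rewrite addn0 leqnn pn q0.
  by rewrite leqNgt addnS ltnS leq_addr /= -addnS addKn.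
have rz i : zeta (n + i)%N = eta i by rewrite /zeta ltnNge leq_addr /= addKn.
have tr : tagged_partition a c (n + m) r zeta.
  split; first by rewrite /r leq0n.
  split; first by rewrite rr.
  move=> i; case: (ltnP i n) => [h _|h]; first by have [-> [-> ->]] := rl _ h; exact: hp.
  rewrite -(subnKC h) ltn_add2l -addnS !rr rz; exact: hq'.
have {H3} h3 : `|riemann_sum f (n + m) r zeta - K| < e / 3.
  apply: H3 => // i; case: (ltnP i n) => [h _|h].
    by have [-> [-> _]] := rl _ h; have := hm _ h; rewrite !lt_min => /and3P[].
  rewrite -(subnKC h) ltn_add2l -addnS !rr => /hq.
  by rewrite !lt_min => /and3P[].
move: h3; have -> : riemann_sum f (n + m) r zeta =
    riemann_sum f n p xi + riemann_sum f m q eta.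
  rewrite /riemann_sum big_split_ord /=; congr (_ + _); apply: eq_bigr => i _ /=.
    by have [-> [-> ->]] := rl _ (ltn_ord i).
  by rewrite -addnS !rr rz.
set A := riemann_sum _ _ _ _ in h1 *; set B := riemann_sum _ _ _ _ in h2 *.
move=> h3.
have -> : K - (I + J) = (A - I) + (B - J) - (A + B - K).
  by rewrite addrACA -opprD opprB [RHS]addrC addrA subrK.
apply: le_trans (ler_normB _ _) _; have := ler_normD (A - I) (B - J); lra.
Qed.

(** Building block of step functions. The value of [P] at [c] is left open, so that [c <= s] and
    [c < s] are both covered, and [c] may lie outside [a, b]. *)
Lemma is_RInt_jump (P : pred R) a b c (v : X) : a <= b ->
  (forall s, s < c -> ~~ P s) -> (forall s, c < s -> P s) ->
  exists I, is_RInt (fun s => if P s then v else 0) a b I.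
Proof.
(* The scalar is the length of the part of [a, b] to the right of [c], wherever [c] lies. *)
move=> ab Pl Pr; exists ((Num.max b c - Num.max a c) *: v) => e e0.
pose d := e / (1 + `|v|).
have v1 : 0 < 1 + `|v| by rewrite ltr_wpDr.
have d0 : 0 < d by rewrite divr_gt0.
exists d; split=> // n p xi tp hm.
pose S j := \sum_(i < j) (p i.+1 - p i) * (P (xi i))%:R.
have -> : riemann_sum (fun s => if P s then v else 0) n p xi = S n *: v.
  rewrite /riemann_sum /S scaler_suml; apply: eq_bigr => i _.
  by case: (P _); rewrite ?mulr1 ?mulr0 ?scaler0 ?scale0r.
rewrite -scalerBl normrZ.
suff h : `|S n - (Num.max b c - Num.max a c)| <= d.
  apply: (@le_lt_trans _ _ (d * `|v|)); first by rewrite ler_wpM2r.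
  have -> : e = d * (1 + `|v|) by rewrite divfK ?gt_eqF.
  by rewrite ltr_pM2l // ltrDr.
have Pmon x y : x <= y -> P x -> P y.
  rewrite le_eqVlt => /predU1P[->//|xy Px]; apply: Pr; apply: le_lt_trans xy.
  by rewrite leNgt; apply: contraL Px; exact: Pl.
have Pc x : P x -> c <= x by rewrite leNgt; apply: contraL; exact: Pl.
have nPc x : ~~ P x -> x <= c by rewrite leNgt; apply: contra; exact: Pr.
case: (tp) => p0 [pn htag].
(* The sum vanishes while the partition points stay on the left of [c]; the
   only inexact cell is the one which contains [c]. *)
have : forall j, (j <= n)%N -> (~~ P (p j) -> S j = 0) /\
    (P (p j) -> `|S j - (p j - Num.max a c)| <= d).
  elim=> [_|j IH jn].
    rewrite /S big_ord0 p0; split=> // /Pc ca.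
    by rewrite (max_idPl ca) subrr subr0 normr0 ltW.
  have [IH1 IH2] := IH (ltnW jn); have := htag _ jn => /andP[t1 t2].
  have hj := hm _ jn.
  have aj := tagged_partition_ge tp (ltnW jn).
  have -> : S j.+1 = S j + (p j.+1 - p j) * (P (xi j))%:R by rewrite /S big_ord_recr.
  split=> [h|h].
    rewrite IH1; last by apply: contra h; apply: Pmon; exact: le_trans t2.
    by rewrite (negbTE (contra (Pmon _ _ t2) h)) mulr0 addr0.
  case: (boolP (P (p j))) => [h1|h1].
    by rewrite (Pmon _ _ t1 h1) mulr1; have := IH2 h1; rewrite !ler_norml; lra.
  have h2 := nPc _ h1; have h3 := Pc _ h.
  rewrite (IH1 h1) add0r max_r; last lra.
  by case: (P _); rewrite ?mulr1 ?mulr0 ler_norml; lra.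
move=> /(_ n (leqnn n))[h1 h2]; rewrite -pn; case: (boolP (P (p n))) => [h|h].
  by rewrite (max_idPl (Pc _ h)) h2.
rewrite (h1 h) (max_idPr (nPc _ h)) (max_idPr _) ?subrr ?normr0 ?(ltW d0) //.
by rewrite (le_trans ab) // -pn nPc.
Qed.

(** The integrals of approximants within 1/(n+1) of [f] form a Cauchy sequence, because two of them
    differ by at most the uniform distance times the length; completeness of [X] supplies the
    value. *)
Lemma is_RInt_unif f a b : a <= b ->
  (forall e, 0 < e -> exists g J, is_RInt g a b J /\
     forall s, a <= s <= b -> `|f s - g s| <= e) ->
  exists I, is_RInt f a b I.
Proof.
move=> ab Hf.
have /choice[g /choice[J HJ]] : forall n : nat, exists g : R -> X, exists J,
    is_RInt g a b J /\ forall s, a <= s <= b -> `|f s - g s| <= n.+1%:R^-1.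
  by move=> n; apply: Hf; rewrite invr_gt0.
have JJ n m : `|J n - J m| <= (n.+1%:R^-1 + m.+1%:R^-1) * (b - a).
  have [h1 h2] := HJ n; have [h3 h4] := HJ m.
  have := is_RInt_lin (-1) h1 h3; rewrite scaleN1r => /(is_RInt_norm_le_cst ab).
  apply=> s hs; rewrite scaleN1r.
  have -> : g n s - g m s = (f s - g m s) - (f s - g n s).
    by rewrite opprB [RHS]addrC addrA subrK.
  by apply: le_trans (ler_normB _ _) _; rewrite addrC lerD ?h2 ?h4.
have small e : 0 < e -> exists N, forall n, (N <= n)%N -> n.+1%:R^-1 * (1 + (b - a)) < e.
  move=> e0; have ba : 0 < 1 + (b - a) by rewrite ltr_wpDr // subr_ge0.
  exists (Num.bound ((1 + (b - a)) / e)) => n hn.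
  rewrite mulrC ltr_pdivrMr // mulrC -ltr_pdivrMr //.
  apply: lt_le_trans (archi_boundP _) _; first by rewrite divr_ge0 // ltW.
  by rewrite ler_nat (leq_trans hn).
have cJ : cvg (J @ \oo).
  apply: cauchy_cvg; apply/cauchy_ballP => e e0.
  have [|N hN] := small (e / 2); first by rewrite divr_gt0.
  exists (J @` [set n | (N <= n)%N], J @` [set n | (N <= n)%N]) => /=.
    by split; exists N => // n /= hn; exists n.
  move=> [x y] /= [[n hn <-] [m hm <-]].
  rewrite -ball_normE /=; apply: le_lt_trans (JJ _ _) _.
  have := hN _ hn; have := hN _ hm.
  have : 0 < n.+1%:R^-1 :> R by rewrite invr_gt0.
  have : 0 < m.+1%:R^-1 :> R by rewrite invr_gt0.
  by move: (n.+1%:R^-1) (m.+1%:R^-1) (J n) (J m) => y' z' _ _; lra.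
pose I : X := lim (J @ \oo).
exists I => e e0; have e3 : 0 < e / 3 by lra.
have [N hN] := small _ e3.
have [M _ hM] := (cvgrPdist_lt _ _).1 cJ _ e3.
pose n := maxn N M.
have {hM} h1 : `|I - J n| < e / 3 by apply: hM; exact: leq_maxr.
have {hN} h2 := hN n (leq_maxl _ _).
have [HJn hg] := HJ n; have [d [d0 Hd]] := HJn _ e3.
exists d; split=> // m p xi tp hm; have h3 := Hd m p xi tp hm.
have h4 : `|riemann_sum f m p xi - riemann_sum (g n) m p xi| <= n.+1%:R^-1 * (b - a).
  rewrite -scaleN1r -riemann_sum_lin; case: (tp) => p0 [pm _].
  rewrite -pm -p0 /riemann_sum.
  suff key j : (j <= m)%N -> `|\sum_(i < j) (p i.+1 - p i) *: (f (xi i) + -1 *: g n (xi i))|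
      <= n.+1%:R^-1 * (p j - p 0%N) by exact: key.
  elim: j => [_|j IH lin]; first by rewrite big_ord0 normr0 subrr mulr0.
  rewrite big_ord_recr /=; apply: le_trans (ler_normD _ _) _.
  have h5 := IH (ltnW lin).
  have h6 : 0 <= p j.+1 - p j by rewrite subr_ge0 (tagged_partition_step tp).
  rewrite normrZ ger0_norm // scaleN1r.
  have := ler_wpM2l h6 (hg _ (tagged_partition_tag tp lin)).
  move: h5; move: `|\sum_(_ < _) _| `|f _ - _| (n.+1%:R^-1) => u v w.
  rewrite !mulrBr !mulrBl; lra.
have -> : riemann_sum f m p xi - I = (riemann_sum f m p xi - riemann_sum (g n) m p xi)
   + (riemann_sum (g n) m p xi - J n) - (I - J n).
  by rewrite addrA subrK opprB addrA subrK.
apply: le_lt_trans (ler_normB _ _) _.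
have := ler_normD (riemann_sum f m p xi - riemann_sum (g n) m p xi) (riemann_sum (g n) m p xi - J n).
have : 0 < n.+1%:R^-1 :> R by rewrite invr_gt0.
move: h2 h4; rewrite mulrDr mulr1; move: (n.+1%:R^-1) => w.
by move: (w * _) => v; lra.
Qed.

(** A function with one-sided limits is a uniform limit of step functions. The limits ignore the
    value of [f] at the point itself, as the jumps of a piecewise continuous input require. *)
Lemma regulated_is_RInt f a b : a <= b ->
  (forall s, a <= s < b -> exists l, forall e, 0 < e -> exists2 d, 0 < d &
     forall t, s < t < s + d -> t <= b -> `|f t - l| <= e) ->
  (forall s, a < s <= b -> exists l, forall e, 0 < e -> exists2 d, 0 < d &
     forall t, s - d < t < s -> a <= t -> `|f t - l| <= e) ->
  exists I, is_RInt f a b I.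
Proof.
move=> ab Hr Hl; apply: is_RInt_unif => // e e0.
(* [P t] asks for an [e]-approximation of [f] on [a, t] that is constant beyond [t], so that its
   tail can be overwritten by one jump. The left limit shows that the supremum of such [t] is
   attained, the right limit that it can be passed unless it is [b]. *)
pose P t := a <= t <= b /\ exists g v, (exists J, is_RInt g a b J) /\
  (forall s, t < s -> g s = v) /\ forall s, a <= s <= t -> `|f s - g s| <= e.
suff : P b by move=> [_ [g [v [[J HJ] [_ h]]]]]; exists g, J.
have cst (v : X) : exists J, is_RInt (fun=> v) a b J.
  have [||J HJ] := @is_RInt_jump (fun s => a <= s) a b a v ab.
  - by move=> s; rewrite -ltNge.
  - by move=> s; exact: ltW.
  - by exists J; apply: is_RInt_ext HJ => s /andP[-> _].
(* Overwriting the tail value [v] by [v'] amounts to adding a jump of height [v' - v]. *)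
have over g (Q : pred R) c (v v' : X) : (exists J, is_RInt g a b J) ->
   (forall s, s < c -> ~~ Q s) -> (forall s, c < s -> Q s) ->
   (forall s, Q s -> g s = v) ->
   exists J, is_RInt (fun s => if Q s then v' else g s) a b J.
  move=> [J HJ] Ql Qr gv.
  have [K HK] := is_RInt_jump (v' - v) ab Ql Qr.
  exists (J + 1 *: K); apply: is_RInt_ext (is_RInt_lin 1 HJ HK) => s _.
  by case: ifP => [/gv->|_]; rewrite scale1r ?addr0 // addrC subrK.
have Pa : P a.
  split; first by rewrite lexx.
  exists (fun=> f a), (f a); split=> //; split=> // s hs.
  have -> : s = a by apply/le_anti; rewrite andbC.
  by rewrite subrr normr0 ltW.
pose sig := sup [set t | P t].
have hs : has_sup [set t | P t] by split; [exists a|exists b => t [/andP[]]].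
have as_ : a <= sig by apply: ub_le_sup => //; case: hs.
have sb : sig <= b by apply: ge_sup; [exists a|move=> t [/andP[]]].
have Psig : P sig.
  move: as_; rewrite le_eqVlt => /predU1P[<-//|as_].
  have [|l Hlim] := Hl sig; first by rewrite as_ sb.
  have [d d0 hd] := Hlim _ e0.
  have [t Pt ht] := sup_adherent d0 hs; rewrite -/sig in ht.
  have ts : t <= sig by apply: ub_le_sup => //; case: hs.
  move: ts; rewrite le_eqVlt => /predU1P[<-//|ts].
  case: Pt => /andP[at_ tb] [g [v [Hg [gv fg]]]].
  have H1 := over g (fun s => t < s) t v l Hg.
  have {}H1 : exists J, is_RInt (fun s => if t < s then l else g s) a b J.
    by apply: H1 => // s; rewrite -leNgt; exact: ltW.
  have H2 : exists J, is_RInt (fun s => if sig <= s then f sig else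
      (if t < s then l else g s)) a b J.
    apply: (over _ (fun s => sig <= s) sig l) => // s; rewrite -?ltNge //.
      exact: ltW.
    by move=> h; rewrite (lt_le_trans ts h).
  split; first by rewrite ltW.
  exists (fun s => if sig <= s then f sig else (if t < s then l else g s)), (f sig).
  split=> //; split=> [s /ltW->//|s /andP[as1 ss]].
  case: ifP => h; first by rewrite (@le_anti _ _ s sig) ?h ?ss // subrr normr0 ltW.
  have {}h : s < sig by rewrite ltNge h.
  case: ifP => h1; first by apply: hd => //; rewrite h andbT; apply: lt_trans h1.
  by apply: fg; rewrite as1 leNgt h1.
have [<-//|sb'] := eqVneq sig b.
have {sb'}sb' : sig < b by rewrite lt_neqAle sb'.
have [|l Hlim] := Hr sig; first by rewrite as_ sb'.
have [d d0 hd] := Hlim _ e0.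
case: Psig => _ [g [v [Hg [gv fg]]]].
pose t := Num.min b (sig + d / 2).
have st : sig < t by rewrite lt_min sb' ltrDl divr_gt0.
suff : P t.
  by move=> Pt; have := ub_le_sup hs.2 Pt; rewrite leNgt -/sig st.
split; first by rewrite (le_trans as_ (ltW st)) ge_min lexx.
exists (fun s => if sig < s then l else g s), l; split.
  by apply: (over g (fun s => sig < s) sig v l Hg) => // s; rewrite -leNgt; exact: ltW.
split=> [s h|s /andP[as1 ss]]; first by rewrite (lt_trans st h).
case: ifP => h; last by apply: fg; rewrite as1 leNgt h.
move: ss; rewrite le_min => /andP[sb1 ss].
apply: hd => //; rewrite h; apply: le_lt_trans ss _.
by rewrite ltrD2l ltr_pdivrMr // mulr_natr mulr2n ltrDl.
Qed.

End RiemannIntegral.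

(** * Lebesgue integrals: the bridge from Riemann integrals, Gronwall's lemma, measurability of
    inputs *)

Section LebesgueTools.
Context {R : realType}.
Notation mu := (@lebesgue_measure R).
Implicit Types (a b c d e s t N : R) (f g h : R -> R).

Lemma within_continuousP (T : pseudoMetricType R) (V : normedModType R)
    (D : set T) (f : T -> V) :
  {within D, continuous f} <-> forall x, D x -> forall e, 0 < e ->
    exists2 d, 0 < d & forall y, D y -> ball x d y -> `|f x - f y| < e.
Proof.
split=> [/subspace_continuousP cf x Dx e e0|H].
  move: (cf x Dx) => /cvgrPdist_lt /(_ e e0).
  rewrite nearE /within /= => /(proj1 (nbhs_ballP _ _))[d d0 hd].
  by exists d => // y Dy xy; exact: hd.
apply/subspace_continuousP => x Dx; apply/cvgrPdist_lt => e e0.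
have [d d0 hd] := H x Dx e e0.
apply: (proj2 (nbhs_ballP x _)); exists d => //= y xy Dy; exact: hd.
Qed.

Lemma finite_set_measurable (S : set R) : finite_set S -> measurable S.
Proof.
by move=> fS; rewrite -(image_id S) -bigcup_imset1; apply: fin_bigcup_measurable.
Qed.

Lemma bounded_integrable a b f N : measurable_fun `[a, b] f ->
  (forall s, a <= s <= b -> `|f s| <= N) -> mu.-integrable `[a, b] (EFin \o f).
Proof.
move=> mf hN; apply: measurable_bounded_integrable => //.
  by rewrite /= lebesgue_measure_itv /=; case: ifP => // _; rewrite -EFinB ltry.
exists N; split; rewrite ?num_real // => M NM s /=; rewrite in_itv /= => hs.
exact: le_trans (hN _ hs) (ltW NM).
Qed.

Lemma Rintegral_split a b c f : mu.-integrable `[a, c] (EFin \o f) ->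
  a <= b -> b <= c -> \int[mu]_(x in `[a, c]) f x =
  \int[mu]_(x in `[a, b]) f x + \int[mu]_(x in `[b, c]) f x.
Proof.
move=> fi ab bc; rewrite -(@Rintegral_itv_obnd_cbnd _ b (BRight c)).
  rewrite -(Rintegral_itvB fi) ?bnd_simp //.
  by rewrite [RHS]addrC subrK.
by apply: integrableS fi => //; apply: subset_itvr; rewrite bnd_simp.
Qed.

Lemma Rintegral_cst_itv a b (N : R) : a <= b ->
  \int[mu]_(x in `[a, b]) N = N * (b - a).
Proof.
move=> ab; rewrite Rintegral_cst //= lebesgue_measure_itv /= lte_fin.
by move: ab; rewrite le_eqVlt => /predU1P[->|->//]; rewrite ltxx subrr.
Qed.

Lemma Rintegral_subitv a b a' b' f : mu.-integrable `[a, b] (EFin \o f) ->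
  (forall s, a <= s <= b -> 0 <= f s) -> a <= a' -> a' <= b' -> b' <= b ->
  \int[mu]_(x in `[a', b']) f x <= \int[mu]_(x in `[a, b]) f x.
Proof.
move=> fi f0 aa ab bb.
have fi' : mu.-integrable `[a', b] (EFin \o f).
  by apply: integrableS fi => //; apply: subset_itvr; rewrite bnd_simp.
rewrite (Rintegral_split fi aa) ?(le_trans ab) //.
rewrite (Rintegral_split fi' ab bb).
have h1 : 0 <= \int[mu]_(x in `[a, a']) f x.
  apply: Rintegral_ge0 => s /=; rewrite in_itv /= => /andP[s1 s2].
  by apply: f0; rewrite s1 (le_trans s2) // (le_trans ab).
have h2 : 0 <= \int[mu]_(x in `[b', b]) f x.
  apply: Rintegral_ge0 => s /=; rewrite in_itv /= => /andP[s1 s2].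
  by apply: f0; rewrite s2 andbT (le_trans aa) // (le_trans ab).
by rewrite addrCA lerDl addr_ge0.
Qed.

(** With [G] the indefinite integral of [h], each cell has a good tag: otherwise [h] would exceed
    its mean over the cell by [e] at every point, and integrating this contradicts the definition of
    the mean. *)
Lemma is_RInt_norm_le_Rintegral (X : completeNormedModType R) (f : R -> X) a b I h :
  a <= b -> is_RInt f a b I -> mu.-integrable `[a, b] (EFin \o h) ->
  (forall s, a <= s <= b -> `|f s| <= h s) ->
  `|I| <= \int[mu]_(s in `[a, b]) h s.
Proof.
move=> ab HI hi fh; have := @is_RInt_norm_le _ _ f a b I
  (fun t => \int[mu]_(s in `[a, t]) h s) ab HI.
rewrite set_itv1 Rintegral_set1 subr0; apply=> p q e ap pq qb e0.
have sub c d : a <= c -> d <= b -> mu.-integrable `[c, d] (EFin \o h).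
  by move=> ac db; apply: integrableS hi => //; apply: subset_itv; rewrite bnd_simp.
have -> : \int[mu]_(s in `[a, q]) h s - \int[mu]_(s in `[a, p]) h s =
    \int[mu]_(s in `[p, q]) h s.
  by rewrite (Rintegral_split (sub a q (lexx a) qb) ap pq) addrAC subrr add0r.
move: pq; rewrite le_eqVlt => /predU1P[<-|pq].
  by exists p; rewrite lexx subrr set_itv1 Rintegral_set1 mulr0 mul0r addr0.
apply: contrapT => H.
have {}H s : p <= s <= q -> \int[mu]_(s in `[p, q]) h s + e * (q - p) <= (q - p) * h s.
  move=> hs; rewrite leNgt; apply/negP => hlt; apply: H; exists s; split=> //.
  apply: le_trans (ltW hlt); rewrite ler_wpM2l ?subr_ge0 ?(ltW pq) //; apply: fh.
  by case/andP: hs => s1 s2; rewrite (le_trans ap s1) (le_trans s2 qb).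
have qp : 0 < q - p by rewrite subr_gt0.
set J := \int[mu]_(s in _) _ in H.
have : \int[mu]_(s in `[p, q]) (J / (q - p) + e) <= J.
  apply: le_Rintegral => //.
  - by apply: (bounded_integrable (N := `|J / (q - p) + e|)).
  - exact: sub.
  - move=> s /=; rewrite in_itv /= => /H; rewrite -ler_pdivrMl //.
    by rewrite mulrDr mulrC [_ * (e * _)]mulrC -mulrA divff ?mulr1 // gt_eqF.
rewrite (Rintegral_cst_itv _ (ltW pq)) mulrDl divfK ?gt_eqF //.
by rewrite gerDl leNgt mulr_gt0.
Qed.

(* On a cell of [g]-mass x <= 1/2 the integral inequality gives the growth factor
   1 / (1 - x) <= e^{2x}; this is where the factor 2 in [gronwall] comes from. *)
Lemma cell_gronwall (x : R) : 0 <= x <= 2^-1 -> 1 <= expR (2 * x) * (1 - x).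
Proof.
move=> /andP[x0 x1]; apply: (@le_trans _ _ ((1 + 2 * x) * (1 - x))).
  have : 0 <= x * (1 - 2 * x) by rewrite mulr_ge0 //; lra.
  lra.
by rewrite ler_wpM2r ?expR_ge1Dx //; lra.
Qed.

(** Only boundedness and measurability of [y] and [g] are used. The interval is exhausted by cells
    of length [h], by induction on their number, and each cell multiplies the bound by the
    exponential of twice its [g]-mass. *)
Lemma gronwall a b (A : R) (y : R -> R) g (Ny Ng : R) : a <= b -> 0 <= A ->
  measurable_fun `[a, b] y -> measurable_fun `[a, b] g ->
  (forall s, a <= s <= b -> 0 <= y s <= Ny) ->
  (forall s, a <= s <= b -> 0 <= g s <= Ng) ->
  (forall t, a <= t <= b -> y t <= A + \int[mu]_(s in `[a, t]) (g s * y s)) ->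
  y b <= A * expR (2 * \int[mu]_(s in `[a, b]) g s).
Proof.
move=> ab A0 my mg hy hg Hy.
have gi : mu.-integrable `[a, b] (EFin \o g).
  by apply: (bounded_integrable (N := Ng)) => // s /hg/andP[h1 h2]; rewrite ger0_norm.
have gyi : mu.-integrable `[a, b] (EFin \o (fun s => g s * y s)).
  apply: (bounded_integrable (N := Ng * Ny)); first exact: measurable_funM.
  move=> s hs; have /andP[s0 s1] := hg _ hs; have /andP[y0 y1] := hy _ hs.
  by rewrite ger0_norm ?mulr_ge0 // ler_pM.
have sub f c d : mu.-integrable `[a, b] (EFin \o f) -> a <= c -> d <= b ->
    mu.-integrable `[c, d] (EFin \o f).
  by move=> fi ac db; apply: integrableS fi => //; apply: subset_itv; rewrite bnd_simp.
pose F t := A + \int[mu]_(s in `[a, t]) (g s * y s).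
pose G t := \int[mu]_(s in `[a, t]) g s.
have g0 s : a <= s <= b -> 0 <= g s by move=> /hg/andP[].
have gN s : a <= s <= b -> g s <= Ng by move=> /hg/andP[].
have gy0 s : a <= s <= b -> 0 <= g s * y s.
  by move=> hs; rewrite mulr_ge0 ?g0 //; case/andP: (hy _ hs).
have Ng0 : 0 <= Ng by apply: le_trans (g0 a _) (gN a _); rewrite lexx.
(* Chosen so that a cell of length [h] has [g]-mass at most 1/2, as [cell_gronwall] demands. *)
pose h := (2 * (Ng + 1))^-1.
have h0 : 0 < h by rewrite invr_gt0 mulr_gt0 // ltr_wpDl.
have hNg : Ng * h <= 2^-1.
  rewrite /h invfM mulrCA ler_piMr // ?invr_ge0 // ler_pdivrMr ?mul1r ?ler_wpDr //.
  by rewrite ltr_wpDl.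
clearbody h.
have F0 t : a <= t <= b -> 0 <= F t.
  move=> /andP[at_ tb]; rewrite addr_ge0 // Rintegral_ge0 // => s /=.
  rewrite in_itv /= => /andP[s1 s2]; have hs : a <= s <= b by rewrite s1 (le_trans s2).
  exact: gy0.
suff key : forall n t, a <= t <= b -> t - a <= n%:R * h -> F t <= A * expR (2 * G t).
  have bb : a <= b <= b by rewrite ab lexx.
  apply: le_trans (Hy _ bb) _.
  apply: (key (Num.bound ((b - a) / h))) => //.
  rewrite -ler_pdivrMr //; apply/ltW/archi_boundP.
  by rewrite divr_ge0 ?subr_ge0 ?(ltW h0).
elim=> [|n IH] t /andP[at_ tb] hn.
  have -> : t = a by apply/le_anti; rewrite at_ andbT; move: hn; rewrite mul0r subr_le0.
  by rewrite /F /G set_itv1 !Rintegral_set1 mulr0 expR0 mulr1 addr0.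
pose s := Num.max a (t - h).
have as_ : a <= s by rewrite le_max lexx.
have st : s <= t by rewrite ge_max at_ gerBl ltW.
have hs : a <= s <= b by rewrite as_ (le_trans st).
have sn : s - a <= n%:R * h.
  rewrite lerBlDr ge_max lerDr mulr_ge0 // ?(ltW h0) //=.
  by rewrite lerBlDr addrAC -lerBlDr; move: hn; rewrite -natr1 mulrDl mul1r.
have IHs := IH _ hs sn.
have Gst : G t = G s + \int[mu]_(x in `[s, t]) g x.
  exact: Rintegral_split (sub _ _ _ gi (lexx a) tb) as_ st.
have Fst : F t = F s + \int[mu]_(x in `[s, t]) (g x * y x).
  rewrite /F (Rintegral_split (sub _ _ _ gyi (lexx a) tb) as_ st).
  by rewrite addrA.
set D := \int[mu]_(x in `[s, t]) g x in Gst.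
have D0 : 0 <= D.
  apply: Rintegral_ge0 => x /=; rewrite in_itv /= => /andP[x1 x2].
  by apply: g0; rewrite (le_trans as_ x1) (le_trans x2).
have D1 : D <= 2^-1.
  apply: le_trans hNg; apply: (@le_trans _ _ (Ng * (t - s))).
    rewrite -Rintegral_cst_itv //; apply: le_Rintegral => //.
    - exact: sub.
    - by apply: (bounded_integrable (N := `|Ng|)).
    - move=> x /=; rewrite in_itv /= => /andP[x1 x2].
      by apply: gN; rewrite (le_trans as_ x1) (le_trans x2).
  by rewrite ler_wpM2l // lerBlDr -lerBlDl le_max lexx orbT.
(* On [s, t] one has y <= F <= F t, since [F] is nondecreasing. This makes the inequality implicit
   in [F t], and D <= 1/2 allows solving it. *)
have FD : F t <= F s + F t * D.
  rewrite {1}Fst lerD2l /D -RintegralZl //; last exact: sub.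
  apply: le_Rintegral => //; first exact: sub.
    rewrite (_ : EFin \o _ = fun x => ((F t)%:E * (g x)%:E)%E).
      by apply: integrableZl => //; exact: sub.
    by apply/funext => x; rewrite /= EFinM.
  move=> x /=; rewrite in_itv /= => /andP[x1 x2].
  have hx : a <= x <= b by rewrite (le_trans as_ x1) (le_trans x2).
  rewrite mulrC ler_wpM2r ?g0 //.
  apply: le_trans (Hy _ hx) _; rewrite lerD2l.
  apply: Rintegral_subitv => //; first exact: sub.
    move=> z /andP[z1 z2]; have hz : a <= z <= b by rewrite z1 (le_trans z2).
    exact: gy0.
  by case/andP: hx.
have h1 := cell_gronwall (x := D); rewrite D0 D1 in h1.
have Ft0 : 0 <= F t by apply: F0; rewrite at_.
rewrite Gst mulrDr expRD mulrA.
apply: (@le_trans _ _ (F s * expR (2 * D))); last by rewrite ler_wpM2r ?expR_ge0.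
apply: (@le_trans _ _ (F t * (1 - D) * expR (2 * D))).
  by rewrite -mulrA [(1 - D) * _]mulrC -[leLHS]mulr1 ler_wpM2l ?h1.
by rewrite ler_wpM2r ?expR_ge0 // mulrBr mulr1 lerBlDr.
Qed.

(** [class_K] controls [del] on the nonnegative half-line only; composing with the absolute value
    gives continuity on the whole line, in the form needed for measurability. *)
Lemma class_K_norm_continuous (del : R -> R) : class_K del -> continuous (fun r : R => del `|r|).
Proof.
move=> [/within_continuousP cd _] x; apply/cvgrPdist_lt => e e0.
have [d d0 hd] := cd `|x| (normr_ge0 x) e e0.
apply/nbhs_ballP; exists d => // y xy.
apply: hd; first exact: normr_ge0.
by apply: le_lt_trans xy; exact: ler_dist_dist.
Qed.

Lemma class_K_ge0 (del : R -> R) : class_K del -> forall r, 0 <= r -> 0 <= del r.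
Proof.
move=> [_ [d0 hd]] r; rewrite le_eqVlt => /predU1P[<-|r0]; first by rewrite d0.
by rewrite -d0 ltW // hd.
Qed.

Lemma class_K_le (del : R -> R) : class_K del -> forall r s, 0 <= r -> r <= s -> del r <= del s.
Proof.
move=> [_ [d0 hd]] r s r0; rewrite le_eqVlt => /predU1P[<-//|rs]; exact/ltW/hd.
Qed.

(** Off a finite set the function is continuous, and on a finite set every function is
    measurable. *)
Lemma PC_measurable (U : completeNormedModType R) (u : R -> U) (g : U -> R) a b :
  PC u -> continuous g -> 0 <= a -> measurable_fun `[a, b] (fun s => g (u s)).
Proof.
move=> [_ [_ [cu _]]] cg a0; have [S hS] := cu b.
(* [PC] gives continuity at positive times only; removing [a], which may be 0, leaves only such
   times. *)
pose S' := [set x | x \in a :: S].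
have fS : finite_set S' by exact: finite_seq.
have mS : measurable (S' : set R).
  exact: finite_set_measurable.
rewrite -(setIidl (subsetT `[a, b])) -(setUv S') setIUr.
apply/measurable_funU; [exact: measurableI|by apply: measurableI => //; exact: measurableC|split].
  move=> _ Y _; apply: finite_set_measurable.
  by apply: sub_finite_set fS => x [[]].
apply: subspace_continuous_measurable_fun.
  by apply: measurableI => //; exact: measurableC.
apply: continuous_in_subspaceT => x; rewrite inE => -[/=]; rewrite in_itv /=.
move=> /andP[ax xb] /negP; rewrite /S' /= inE negb_or => /andP[xa xS].
apply: continuous_comp; last exact: cg.
apply: hS => //; rewrite xb andbT; apply: le_lt_trans a0 _.
by rewrite lt_neqAle eq_sym xa.
Qed.

End LebesgueTools.

(** * Integrals of decaying exponentials over half-lines *)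

Section ExponentialIntegral.
Context {R : realType}.
Notation mu := (@lebesgue_measure R).
Implicit Types (c t : R).


Lemma is_derive_exp_shift c t (x : R) :
  is_derive x 1 (fun y => expR (- c * (y - t))) (- c * expR (- c * (x - t))).
Proof.
apply: is_derive_eq; rewrite /GRing.scale /=; ring.
Qed.

Lemma continuous_exp_shift c t : continuous (fun y : R => expR (- c * (y - t))).
Proof.
by move=> x; apply: differentiable_continuous; apply/derivable1_diffP;
  have [] := is_derive_exp_shift c t x.
Qed.

Lemma cvg_exp_shift c t : 0 < c -> expR (- c * (x - t)) @[x --> +oo] --> (0 : R).
Proof.
move=> c0; rewrite (_ : (fun _ => _) = (fun z => expR (- z)) \o (fun x => c * (x - t))); last first.
  by apply/funext => x /=; rewrite mulNr.
apply: cvg_comp; last exact: cvgr_expR.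
apply/cvgryPge => A; near=> x.
rewrite -ler_pdivrMl // lerBrDr.
near: x; apply: nbhs_pinfty_ge; exact: num_real.
Unshelve. all: by end_near. Qed.

Lemma ge0_integral_exp c t : 0 < c ->
  (\int[mu]_(x in `[t, +oo[) (expR (- c * (x - t)))%:E = (c^-1)%:E)%E.
Proof.
move=> c0; rewrite (@ge0_continuous_FTC2y _ _
  (fun x => - c^-1 * expR (- c * (x - t))) t 0).
- by rewrite subrr mulr0 expR0 mulr1 -EFinB sub0r opprK.
- by move=> x _; exact: expR_ge0.
- exact/continuous_subspaceT/continuous_exp_shift.
- rewrite -[X in _ --> X](mulr0 (- c^-1)); apply: cvgMr; exact: cvg_exp_shift.
- by move=> x _; apply: derivableM => //; have [] := is_derive_exp_shift c t x.
- apply: cvg_at_right_filter; apply: cvgMr; exact: continuous_exp_shift.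
- move=> x _; rewrite derive1E deriveZ /=; last by have [] := is_derive_exp_shift c t x.
  have := is_derive_exp_shift c t x => dx; rewrite derive_val /GRing.scale /=.
  by rewrite mulrA mulNr mulrN opprK mulVf ?gt_eqF // mul1r.
Qed.

Lemma integrable_exp c t : 0 < c ->
  mu.-integrable `[t, +oo[ (EFin \o (fun x => expR (- c * (x - t)))).
Proof.
move=> c0; apply/integrableP; split.
  apply/measurable_EFinP; apply: measurable_funS (@measurableT _ _) _ _ => //.
  apply: continuous_measurable_fun; exact: continuous_exp_shift.
under eq_integral do rewrite /= ger0_norm ?expR_ge0 //.
by rewrite ge0_integral_exp // ltry.
Qed.

Lemma Rintegral_exp c t : 0 < c ->
  \int[mu]_(x in `[t, +oo[) expR (- c * (x - t)) = c^-1.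
Proof. by move=> c0; rewrite /Rintegral ge0_integral_exp. Qed.

End ExponentialIntegral.

(** * The functional V: quadratic bounds, splitting along free motions, Lipschitz estimate,
    continuity *)

Section LyapunovFunctional.
Context {R : realType} {X : completeNormedModType R}.
Notation mu := (@lebesgue_measure R).
Variables (W : R -> R -> {linear X -> X}) (k w M lam : R).
Implicit Types (t s r e : R) (x y : X).
Hypothesis W_id : forall s, 0 <= s -> forall x, W s s x = x.
Hypothesis W_comp : forall t r s, 0 <= s <= r -> r <= t ->
  forall x, W t s x = W t r (W r s x).
Hypothesis W_cont : forall x, {within [set q : R * R | 0 <= q.2 <= q.1],
  continuous (fun q : R * R => W q.1 q.2 x)}.
Hypothesis k0 : 0 < k.
Hypothesis w0 : 0 < w.
Hypothesis W_stab : forall t s x, 0 <= s <= t ->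
  `|W t s x| <= k * expR (- w * (t - s)) * `|x|.
Hypothesis M0 : 0 < M.
Hypothesis lam0 : 0 < lam.
Hypothesis W_low : forall t s x, 0 <= s <= t ->
  M * expR (- lam * (t - s)) * `|x| <= `|W t s x|.

Lemma evol_norm_le t s x : 0 <= s <= t -> `|W t s x| <= k * `|x|.
Proof.
move=> /andP[s0 st]; apply: le_trans (W_stab _ _) _; first by rewrite s0.
rewrite ler_wpM2r // ler_piMr ?(ltW k0) // -[leRHS]expR0 ler_expR.
by rewrite mulNr oppr_le0 mulr_ge0 ?(ltW w0) // subr_ge0.
Qed.

Lemma evol_continuous_eps x t s e : 0 <= s <= t -> 0 < e -> exists2 d, 0 < d &
  forall t' s', 0 <= s' <= t' -> `|t - t'| < d -> `|s - s'| < d ->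
    `|W t s x - W t' s' x| < e.
Proof.
move=> st e0; have /within_continuousP h := @W_cont x.
have [d d0 hd] := h (t, s) st e e0; exists d => // t' s' st' tt ss.
exact: (hd (t', s')).
Qed.

Lemma evol_continuous_to x s : 0 <= s ->
  {within [set t | s <= t], continuous (fun t => W t s x)}.
Proof.
move=> s0; apply/within_continuousP => t st e e0.
have [||d d0 hd] := @evol_continuous_eps x t s e; rewrite ?s0 //.
exists d => // t' st' tt'; apply: hd => //; first by rewrite s0.
by rewrite subrr normr0.
Qed.

Lemma evol_near_id x t e : 0 <= t -> 0 < e -> exists2 d, 0 < d &
  forall s r, 0 <= s <= r -> `|t - s| < d -> `|t - r| < d -> `|W r s x - x| < e.
Proof.
move=> t0 e0; have [||d d0 hd] := @evol_continuous_eps x t t e; rewrite ?t0 ?lexx //.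
exists d => // s r sr ts tr.
by rewrite distrC -{1}(W_id t0 x); apply: hd.
Qed.

Notation q x t := (fun tau => `|W tau t x| ^+ 2).

Lemma measurable_evol_norm x t : 0 <= t ->
  measurable_fun `[t, +oo[ (fun tau => `|W tau t x|).
Proof.
move=> t0; apply: subspace_continuous_measurable_fun => //.
apply/within_continuousP => s /=; rewrite in_itv /= andbT => ts e e0.
have /within_continuousP h := @evol_continuous_to x t t0.
have [d d0 hd] := h s ts e e0.
exists d => // s'; rewrite /= in_itv /= andbT => ts' ss'.
by apply: le_lt_trans (hd _ ts' ss'); exact: ler_dist_dist.
Qed.

(** Stated for two vectors because the Lipschitz estimate for V pairs [x - y] with [x] and with
    [y]. *)
Lemma evol_mul_le x y t tau : 0 <= t <= tau ->
  `|W tau t x| * `|W tau t y| <= k ^+ 2 * `|x| * `|y| * expR (- (2 * w) * (tau - t)).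
Proof.
move=> tt; have -> : - (2 * w) * (tau - t) = - w * (tau - t) + - w * (tau - t) by ring.
rewrite expRD; apply: le_trans (ler_pM _ _ (W_stab x tt) (W_stab y tt)) _ => //.
rewrite le_eqVlt; apply/orP; left; apply/eqP; ring.
Qed.

Lemma integrable_evol_mul x y t : 0 <= t ->
  mu.-integrable `[t, +oo[ (EFin \o (fun tau => `|W tau t x| * `|W tau t y|)).
Proof.
move=> t0.
apply: (@le_integrable _ _ R mu _ _ _
  (EFin \o (fun tau => k ^+ 2 * `|x| * `|y| * expR (- (2 * w) * (tau - t))))) => //.
- by apply/measurable_EFinP; apply: measurable_funM; exact: measurable_evol_norm.
- move=> tau; rewrite /= in_itv /= andbT => ttau; rewrite lee_fin.
  rewrite !ger0_norm ?mulr_ge0 ?expR_ge0 ?exprn_ge0 ?(ltW k0) //.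
  by apply: evol_mul_le; rewrite t0.
rewrite (_ : EFin \o _ = fun tau => ((k ^+ 2 * `|x| * `|y|)%:E *
    (EFin \o (fun tau => expR (- (2 * w) * (tau - t)))) tau)%E).
  by apply: integrableZl => //; apply: integrable_exp; rewrite mulr_gt0.
by apply/funext => tau /=; rewrite EFinM.
Qed.

Lemma integrable_evol_sqr x t : 0 <= t -> mu.-integrable `[t, +oo[ (EFin \o q x t).
Proof.
move=> t0; rewrite (_ : EFin \o _ = EFin \o (fun tau => `|W tau t x| * `|W tau t x|)).
  exact: integrable_evol_mul.
by apply/funext => tau /=; rewrite expr2.
Qed.

(** The integral of k^2 e^{-2w(tau - t)} over tau >= t. It serves both as the quadratic upper
    constant of V and as its Lipschitz factor. *)
Definition vcst := k ^+ 2 / (2 * w).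

Lemma vcst_gt0 : 0 < vcst.
Proof. by rewrite divr_gt0 ?exprn_gt0 ?mulr_gt0. Qed.

Lemma Rintegral_evol_mul x y t : 0 <= t ->
  \int[mu]_(tau in `[t, +oo[) (`|W tau t x| * `|W tau t y|) <= vcst * `|x| * `|y|.
Proof.
move=> t0; have w20 : 0 < 2 * w by rewrite mulr_gt0.
have ie := integrable_exp t w20.
apply: (@le_trans _ _ (\int[mu]_(tau in `[t, +oo[)
   (k ^+ 2 * `|x| * `|y| * expR (- (2 * w) * (tau - t))))).
  apply: le_Rintegral => //; first exact: integrable_evol_mul.
    rewrite (_ : EFin \o _ = fun tau => ((k ^+ 2 * `|x| * `|y|)%:E *
       (EFin \o (fun tau => expR (- (2 * w) * (tau - t)))) tau)%E).
      exact: integrableZl.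
    by apply/funext => tau /=; rewrite EFinM.
  by move=> tau; rewrite /= in_itv /= andbT => tt; apply: evol_mul_le; rewrite t0.
rewrite RintegralZl // Rintegral_exp // /vcst le_eqVlt; apply/orP; left; apply/eqP.
by ring.
Qed.

Lemma Vfun_ub x t : 0 <= t -> Vfun W t x <= vcst * `|x| ^+ 2.
Proof.
move=> t0; rewrite expr2 mulrA; apply: le_trans (Rintegral_evol_mul x x t0).
by rewrite /Vfun; under eq_Rintegral do rewrite expr2.
Qed.

Lemma Vfun_ge0 x t : 0 <= Vfun W t x.
Proof. by apply: Rintegral_ge0 => tau _; rewrite exprn_ge0. Qed.

Lemma Vfun_lb x t : 0 <= t -> M ^+ 2 / (2 * lam) * `|x| ^+ 2 <= Vfun W t x.
Proof.
move=> t0; have l20 : 0 < 2 * lam by rewrite mulr_gt0.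
have ie := integrable_exp t l20.
have -> : M ^+ 2 / (2 * lam) * `|x| ^+ 2 =
    \int[mu]_(tau in `[t, +oo[) (M ^+ 2 * `|x| ^+ 2 * expR (- (2 * lam) * (tau - t))).
  by rewrite RintegralZl // Rintegral_exp // mulrAC.
apply: le_Rintegral => //; last 2 first.
- exact: integrable_evol_sqr.
- move=> tau; rewrite /= in_itv /= andbT => tt.
  have h : 0 <= t <= tau by rewrite t0.
  have -> : - (2 * lam) * (tau - t) = - lam * (tau - t) + - lam * (tau - t) by ring.
  rewrite expRD -expr2 -!exprMn mulrAC ler_sqr ?nnegrE ?W_low //.
  by rewrite !mulr_ge0 ?expR_ge0 ?(ltW M0).
rewrite (_ : EFin \o _ = fun tau => ((M ^+ 2 * `|x| ^+ 2)%:E *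
       (EFin \o (fun tau => expR (- (2 * lam) * (tau - t)))) tau)%E).
  exact: integrableZl.
by apply/funext => tau /=; rewrite EFinM.
Qed.

(** The cocycle law turns the tail of the integral into V at time [s] of the moved point. This exact
    identity takes the place of differentiating V along the free motion. *)
Lemma Vfun_split x t s : 0 <= t -> t <= s ->
  Vfun W t x = \int[mu]_(tau in `[t, s]) (`|W tau t x| ^+ 2) + Vfun W s (W s t x).
Proof.
move=> t0 ts; have iq := integrable_evol_sqr x t0.
have := Rintegral_itvB (x := s) iq; rewrite !bnd_simp => /(_ ts isT) h.
rewrite /Vfun -[LHS](subrK (\int[mu]_(tau in `[t, s]) (`|W tau t x| ^+ 2))) h addrC.
congr (_ + _); rewrite Rintegral_itv_obnd_cbnd; last first.
  by apply: integrableS iq => //; apply: subset_itvr; rewrite bnd_simp.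
apply: eq_Rintegral => tau; rewrite inE /= in_itv /= andbT => stau.
by rewrite (@W_comp tau s t) // t0.
Qed.

(** Factor the difference of squares of norms: the first factor is at most |W(tau,t)(x - y)| by
    linearity and the triangle inequality. *)
Lemma Vfun_lip x y t : 0 <= t ->
  Vfun W t x - Vfun W t y <= vcst * `|x - y| * (`|x| + `|y|).
Proof.
move=> t0; have [ix iy] := (integrable_evol_sqr x t0, integrable_evol_sqr y t0).
have ixy z := integrable_evol_mul (x - y) z t0.
rewrite /Vfun -RintegralB //.
apply: (@le_trans _ _ (\int[mu]_(tau in `[t, +oo[)
   (`|W tau t (x - y)| * `|W tau t x| + `|W tau t (x - y)| * `|W tau t y|))).
  apply: le_Rintegral => //.
  - rewrite (_ : EFin \o _ = ((EFin \o (q x t)%R) \- (EFin \o (q y t)%R))%E).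
      exact: integrableB.
    by apply/funext => tau /=; rewrite EFinB.
  - rewrite (_ : EFin \o _ =
      ((EFin \o (fun tau => `|W tau t (x - y)| * `|W tau t x|)%R) \+
       (EFin \o (fun tau => `|W tau t (x - y)| * `|W tau t y|)%R))%E).
      exact: integrableD.
    by apply/funext => tau /=; rewrite EFinD.
  move=> tau _; rewrite -mulrDr subr_sqr ler_wpM2r ?addr_ge0 // linearB.
  exact: lerB_dist.
rewrite RintegralD // mulrDr lerD ?Rintegral_evol_mul //.
Qed.

Lemma Vfun_dist x y t : 0 <= t ->
  `|Vfun W t x - Vfun W t y| <= vcst * `|x - y| * (`|x| + `|y|).
Proof.
move=> t0; rewrite ler_norml Vfun_lip // andbT lerNl opprB.
by apply: le_trans (Vfun_lip y x t0) _; rewrite distrC [X in _ * X]addrC.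
Qed.

Lemma Rintegral_evol_sqr_le x t s : 0 <= t -> t <= s ->
  0 <= \int[mu]_(tau in `[t, s]) (`|W tau t x| ^+ 2) <= (k * `|x|) ^+ 2 * (s - t).
Proof.
move=> t0 ts; rewrite Rintegral_ge0 /=; last by move=> ? _; rewrite exprn_ge0.
rewrite -(Rintegral_cst_itv _ ts); apply: le_Rintegral => //.
- apply: integrableS (integrable_evol_sqr x t0) => //; apply: subset_itvl.
  by rewrite bnd_simp.
- by apply: (bounded_integrable (N := `|(k * `|x|) ^+ 2|)).
move=> tau; rewrite /= in_itv /= => /andP[h _].
by rewrite ler_sqr ?nnegrE ?mulr_ge0 ?(ltW k0) // evol_norm_le // t0.
Qed.

Lemma Rintegral_evol_sqr_ge x t e : 0 <= t -> 0 < e -> exists2 d, 0 < d &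
  forall s, t <= s -> s < t + d ->
    (`|x| ^+ 2 - e) * (s - t) <= \int[mu]_(tau in `[t, s]) (`|W tau t x| ^+ 2).
Proof.
move=> t0 e0; have x1 : 0 < 2 * `|x| + 1 by rewrite ltr_wpDl ?mulr_ge0.
(* With a = |x| and b = |W(tau,t)x| < a, a^2 - b^2 = (a - b)(a + b) <= 2a(a - b), so this tolerance
   costs at most [e]; the [+ 1] covers x = 0. *)
have [|d d0 hd] := @evol_near_id x t (e / (2 * `|x| + 1)) t0; first by rewrite divr_gt0.
exists d => // s ts sd.
rewrite -(Rintegral_cst_itv _ ts); apply: le_Rintegral => //.
- by apply: (bounded_integrable (N := `| (`|x| ^+ 2 - e) |)).
- apply: integrableS (integrable_evol_sqr x t0) => //; apply: subset_itvl.
  by rewrite bnd_simp.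
move=> tau; rewrite /= in_itv /= => /andP[h1 h2].
have := hd t tau; rewrite t0 h1 subrr normr0 => /(_ isT d0).
rewrite distrC ger0_norm ?subr_ge0 // ltrBlDl => /(_ (le_lt_trans h2 sd)) hx.
have h3 : `|x| <= `|W tau t x| + e / (2 * `|x| + 1).
  rewrite -lerBlDl; apply: le_trans (ltW hx); rewrite distrC; exact: lerB_dist.
have h4 : e / (2 * `|x| + 1) * (2 * `|x| + 1) = e by rewrite divfK ?gt_eqF.
move: h3 h4; have : 0 <= `|W tau t x| by []; have : 0 <= `|x| by [].
move: `|x| `|W _ _ _| (e / _) => a b c a0 b0 h3 h4.
have [ab|ba] := leP a b.
  have : a ^+ 2 <= b ^+ 2 by rewrite ler_sqr ?nnegrE.
  by move: e0; lra.
have c0 : 0 <= c by move: h3 ba; lra.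
have : (a - b) * (a + b) <= c * (2 * a + 1).
  by rewrite ler_pM ?subr_ge0 ?addr_ge0 ?(ltW ba) //; move: h3 ba a0; lra.
by rewrite h4 -subr_sqr; lra.
Qed.

(** Only strong continuity is at hand. In time, [Vfun_split] compares V(t1, x) with V(t2,
    W(t2,t1)x), and a single vector [x] is moved; in space, [Vfun_dist] suffices. *)
Lemma Vfun_continuous : {within [set q : R * X | 0 <= q.1],
  continuous (fun q : R * X => Vfun W q.1 q.2)}.
Proof.
apply/within_continuousP => -[t x] /= t0 e e0.
have c0 : 0 <= vcst by exact/ltW/vcst_gt0.
(* [N] dominates [vcst] times the sum of norms in both uses of [Vfun_dist]: with |W(t2,t1)x| <= k
   |x| in time, and with |y| <= |x| + 1 in space. *)
pose N := vcst * (2 * k * `|x| + 2 * `|x| + 2).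
have N0 : 0 < N.
  by rewrite mulr_gt0 ?vcst_gt0 // ltr_wpDl // addr_ge0 ?mulr_ge0 ?(ltW k0).
have eN : 0 < e / (3 * N) by apply: divr_gt0 => //; apply: mulr_gt0.
have P1 : 0 < (k * `|x|) ^+ 2 + 1 by rewrite ltr_wpDl ?exprn_ge0 ?mulr_ge0 ?(ltW k0).
have [d1 d10 H1] := @evol_near_id x t _ t0 eN.
pose d2 := e / (3 * ((k * `|x|) ^+ 2 + 1)).
have d20 : 0 < d2 by apply: divr_gt0 => //; apply: mulr_gt0.
pose d3 := Num.min 1 (e / (3 * N)).
have d30 : 0 < d3 by rewrite lt_min ltr01.
exists (Num.min d1 (Num.min d2 d3)); first by rewrite !lt_min d10 d20 ltr01.
move=> [s y] /= s0 []; rewrite -!ball_normE /= !lt_min.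
move=> /and4P[ts1 ts2 _ _] /and4P[_ _ xy1 xy2].
(* Stated for an ordered pair, since W(t2,t1) needs t1 <= t2; it is applied to [t] and [s] in
   whichever order they come. *)
have cell t1 t2 : 0 <= t1 -> t1 <= t2 -> `|t - t1| < d1 -> `|t - t2| < d1 ->
    t2 - t1 < d2 -> `|Vfun W t1 x - Vfun W t2 x| < 2 * (e / 3).
  move=> t10 t12 h1 h2 h3; rewrite (Vfun_split x t10 t12) -addrA.
  apply: le_lt_trans (ler_normD _ _) _.
  have t20 := le_trans t10 t12.
  have /andP[i0 i1] := Rintegral_evol_sqr_le x t10 t12.
  have hW : `|W t2 t1 x - x| < e / (3 * N) by apply: H1; rewrite ?t10.
  have -> : 2 * (e / 3) = e / 3 + e / 3 by ring.
  apply: ltr_leD.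
    rewrite ger0_norm //; apply: le_lt_trans i1 _.
    apply: (@le_lt_trans _ _ (((k * `|x|) ^+ 2 + 1) * (t2 - t1))).
      by rewrite ler_wpM2r ?subr_ge0 // lerDl.
    rewrite -ltr_pdivlMl //; apply: lt_le_trans h3 _; rewrite /d2 le_eqVlt.
    by apply/orP; left; apply/eqP; field; rewrite gt_eqF.
  apply: le_trans (Vfun_dist _ _ t20) _.
  have -> : e / 3 = vcst * (e / (3 * N)) * (N / vcst).
    by field; rewrite !gt_eqF ?vcst_gt0.
  apply: ler_pM; [by apply: mulr_ge0|exact: addr_ge0| |].
    by apply: ler_wpM2l => //; exact: ltW.
  rewrite /N mulrC mulKf ?gt_eqF ?vcst_gt0 //.
  have := @evol_norm_le t2 t1 x; rewrite t10 t12 => /(_ isT).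
  have := normr_ge0 x; have : 0 <= k * `|x| by rewrite mulr_ge0 ?(ltW k0).
  by rewrite -mulrA; move: (k * `|x|) `|x| `|_| => a b c; lra.
have h1 : `|Vfun W t x - Vfun W s x| < 2 * (e / 3).
  case: (leP t s) => [ts|/ltW st].
    apply: cell => //; first by rewrite subrr normr0.
    by move: ts2; rewrite distrC ger0_norm ?subr_ge0.
  rewrite distrC; apply: cell => //; first by rewrite subrr normr0.
  by move: ts2; rewrite ger0_norm ?subr_ge0.
have h2 : `|Vfun W s x - Vfun W s y| <= e / 3.
  apply: le_trans (Vfun_dist _ _ s0) _.
  have -> : e / 3 = vcst * (e / (3 * N)) * (N / vcst).
    by field; rewrite !gt_eqF ?vcst_gt0.
  apply: ler_pM; [by apply: mulr_ge0|exact: addr_ge0| |].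
    by apply: ler_wpM2l => //; exact: ltW.
  rewrite /N mulrC mulKf ?gt_eqF ?vcst_gt0 //.
  have h : `|y| <= `|x| + `|x - y|.
    by rewrite -{1}[y](subKr x) (le_trans (ler_normB _ _)).
  have := normr_ge0 x; have : 0 <= k * `|x| by rewrite mulr_ge0 ?(ltW k0).
  move: h xy1; rewrite -mulrA; move: (k * `|x|) `|x| `|y| `|_ - _| => a b c f.
  by lra.
have -> : Vfun W t x - Vfun W s y =
  (Vfun W t x - Vfun W s x) + (Vfun W s x - Vfun W s y) by rewrite addrA subrK.
apply: le_lt_trans (ler_normD _ _) _.
have -> : e = 2 * (e / 3) + e / 3 by field.
exact: ltr_leD.
Qed.

End LyapunovFunctional.

(** The majorant is the derivative of A e^{c(s - t0)}. The left end of each cell is a good tag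
    because 1 + y <= e^y. *)
Lemma is_RInt_norm_le_exp {R : realType} {X : completeNormedModType R}
    (f : R -> X) (a b t0 c A : R) (I : X) :
  a <= b -> 0 <= A -> is_RInt f a b I ->
  (forall s, a <= s <= b -> `|f s| <= c * (A * expR (c * (s - t0)))) ->
  `|I| <= A * expR (c * (b - t0)) - A * expR (c * (a - t0)).
Proof.
move=> ab A0 HI hf.
apply: (is_RInt_norm_le (G := fun s => A * expR (c * (s - t0))) ab HI).
move=> p q e ap pq qb e0; exists p; split; first by rewrite lexx.
have hp := hf p; rewrite ap (le_trans pq qb) in hp.
apply: (@le_trans _ _ (A * expR (c * (q - t0)) - A * expR (c * (p - t0)))); last first.
  by rewrite lerDl mulr_ge0 ?subr_ge0 // ltW.
apply: (@le_trans _ _ ((q - p) * (c * (A * expR (c * (p - t0)))))).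
  by rewrite ler_wpM2l ?subr_ge0 ?hp.
have -> : c * (q - t0) = c * (p - t0) + c * (q - p) by ring.
rewrite expRD [A * (_ * _)]mulrA; have : 0 <= A * expR (c * (p - t0)) by rewrite mulr_ge0 ?expR_ge0.
move: (A * _) => P P0.
have -> : (q - p) * (c * P) = P * (c * (q - p)) by ring.
by have := ler_wpM2l P0 (expR_ge1Dx (c * (q - p))); rewrite mulrDr mulr1 lerBrDl.
Qed.

Lemma geometric_small {R : realType} (C e : R) : 0 < e -> exists n, C / 2 ^+ n < e.
Proof.
move=> e0; exists (Num.bound (`|C| / e)).
rewrite ltr_pdivrMr ?exprn_gt0 // mulrC -ltr_pdivrMr //.
apply: le_lt_trans (_ : `|C| / e < _); first by rewrite ler_pM2r ?invr_gt0 // ler_norm.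
apply: lt_trans (archi_boundP _) _; first by rewrite divr_ge0 // ltW.
by rewrite -natrX ltr_nat ltn_expl.
Qed.

Lemma geometric_cvg {R : realType} {X : completeNormedModType R} (z : nat -> X) (C : R) :
  (forall n, `|z n.+1 - z n| <= C / 2 ^+ n) ->
  forall n, `|lim (z @ \oo) - z n| <= 2 * C / 2 ^+ n.
Proof.
move=> hz.
have C0 : 0 <= C by have := hz 0%N; rewrite expr0 divr1; apply: le_trans.
(* The subtracted term makes the induction on [p] close: the bound telescopes exactly. *)
have h n p : `|z (n + p)%N - z n| <= 2 * C / 2 ^+ n - 2 * C / 2 ^+ (n + p)%N.
  elim: p => [|p IH]; first by rewrite addn0 !subrr normr0.
  rewrite addnS; have -> : z (n + p).+1 - z n =
    (z (n + p).+1 - z (n + p)%N) + (z (n + p)%N - z n) by rewrite addrA subrK.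
  apply: le_trans (ler_normD _ _) _; apply: le_trans (lerD (hz _) IH) _.
  rewrite le_eqVlt; apply/orP; left; apply/eqP; rewrite exprS; field.
  by rewrite !expf_neq0.
have h2 n p : `|z (n + p)%N - z n| <= 2 * C / 2 ^+ n.
  by apply: le_trans (h n p) _; rewrite gerBl divr_ge0 ?mulr_ge0 ?exprn_ge0.
have cz : cvg (z @ \oo).
  apply: cauchy_cvg; apply/cauchy_ballP => e e0.
  have [|N hN] := @geometric_small R (2 * C) (e / 2); first by rewrite divr_gt0.
  exists (z @` [set n | (N <= n)%N], z @` [set n | (N <= n)%N]) => /=.
    by split; exists N => // n /= hn; exists n.
  move=> [x y] /= [[n hn <-] [m hm <-]].
  rewrite -ball_normE /= -(subnKC hn) -(subnKC hm).
  have -> : z (N + (n - N))%N - z (N + (m - N))%N =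
    (z (N + (n - N))%N - z N) - (z (N + (m - N))%N - z N).
    by rewrite opprB addrA subrK.
  apply: le_lt_trans (ler_normB _ _) _.
  have -> : e = e / 2 + e / 2 by field.
  by apply: ltrD; apply: le_lt_trans hN.
move=> n; apply/ler_addgt0Pr => e e0.
have /cvgrPdist_lt/(_ e e0)[N _ hN] := cz.
have h3 : `|lim (z @ \oo) - z (n + N)%N| < e by apply: hN; exact: leq_addl.
have -> : lim (z @ \oo) - z n = (z (n + N)%N - z n) + (lim (z @ \oo) - z (n + N)%N).
  by rewrite [RHS]addrC addrA subrK.
by apply: le_trans (ler_normD _ _) _; rewrite lerD ?h2 ?ltW.
Qed.

(** * Continuity and integrability of the integrand in the variation of constants formula *)

Section MildSolutions.
Context {R : realType} {X U : completeNormedModType R}.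
Variables (W : R -> R -> {linear X -> X}) (k w : R) (Psi : R -> X -> U -> X).
Implicit Types (t s r e : R) (x y z : X).
Hypothesis W_id : forall s, 0 <= s -> forall x, W s s x = x.
Hypothesis W_comp : forall t r s, 0 <= s <= r -> r <= t ->
  forall x, W t s x = W t r (W r s x).
Hypothesis W_cont : forall x, {within [set q : R * R | 0 <= q.2 <= q.1],
  continuous (fun q : R * R => W q.1 q.2 x)}.
Hypothesis k0 : 0 < k.
Hypothesis w0 : 0 < w.
Hypothesis W_stab : forall t s x, 0 <= s <= t ->
  `|W t s x| <= k * expR (- w * (t - s)) * `|x|.
Hypothesis Psi_H1 : H1 Psi.

Let W_le t s x : 0 <= s <= t -> `|W t s x| <= k * `|x|.
Proof. by move=> h; exact: (evol_norm_le k0 w0 W_stab). Qed.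

(** [H1] gives continuity in (t, u) for each fixed x; the Lipschitz bound in x, uniform over bounded
    t and u, upgrades this to continuity in all three variables. *)
Lemma H1_continuous_eps s y (v : U) e : 0 <= s -> 0 < e -> exists2 d, 0 < d &
  forall s' y' v', 0 <= s' -> `|s - s'| < d -> `|y - y'| < d -> `|v - v'| < d ->
    `|Psi s y v - Psi s' y' v'| < e.
Proof.
case: Psi_H1 => Pc Pl s0 e0.
(* Room for every point within distance 1 of [y] and of [v]; the time horizon [s + 1] has the same
   purpose. *)
pose C := `|y| + `|v| + 1.
have C0 : 0 < C by rewrite ltr_wpDl ?addr_ge0.
have s10 : 0 < s + 1 by rewrite ltr_wpDl.
have [L [L0 hL]] := Pl C (s + 1) C0 s10.
have /within_continuousP h := @Pc y.
have e2 : 0 < e / 2 by rewrite divr_gt0.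
have [d1 d10 hd] := h (s, v) s0 _ e2.
have eL : 0 < e / 2 / L by rewrite divr_gt0.
exists (Num.min 1 (Num.min d1 (e / 2 / L))).
  by rewrite !lt_min ltr01 d10.
move=> s' y' v' s'0; rewrite !lt_min => /and3P[s1 s2 _] /and3P[y1 _ y2] /and3P[v1 v2 _].
have -> : Psi s y v - Psi s' y' v' =
   (Psi s y v - Psi s' y v') + (Psi s' y v' - Psi s' y' v') by rewrite addrA subrK.
apply: le_lt_trans (ler_normD _ _) _; have -> : e = e / 2 + e / 2 by field.
apply: ltr_leD.
  by apply: (hd (s', v')) => //; split => //; rewrite -ball_normE.
have hy : `|y'| <= `|y| + `|y - y'|.
  by rewrite -{1}[y'](subKr y) (le_trans (ler_normB _ _)).
have hv : `|v'| <= `|v| + `|v - v'|.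
  by rewrite -{1}[v'](subKr v) (le_trans (ler_normB _ _)).
have : `|Psi s' y v' - Psi s' y' v'| <= L * `|y - y'|.
  have y0 := normr_ge0 y; have v0 := normr_ge0 v.
  apply: hL; rewrite /C; [|lra|lra|lra].
  by move: s1; rewrite ltr_norml => /andP[s1 _]; rewrite s'0; lra.
move=> h1; apply: le_trans h1 _; rewrite -ler_pdivlMl // mulrC ltW //.
Qed.

(** Strong continuity moves [s] with [z] fixed; the uniform bound [k] on the operators then moves
    [z]. *)
Lemma evol_app_eps t s z e : 0 <= s <= t -> 0 < e -> exists2 d, 0 < d &
  forall s' z', 0 <= s' <= t -> `|s - s'| < d -> `|z - z'| < d ->
    `|W t s z - W t s' z'| < e.
Proof.
move=> st e0; have e2 : 0 < e / 2 by rewrite divr_gt0.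
have [d1 d10 hd] := evol_continuous_eps W_cont z st e2.
have ek : 0 < e / 2 / k by rewrite divr_gt0.
exists (Num.min d1 (e / 2 / k)); first by rewrite lt_min d10.
move=> s' z' st'; rewrite !lt_min => /andP[s1 _] /andP[_ z2].
have -> : W t s z - W t s' z' = (W t s z - W t s' z) + W t s' (z - z').
  by rewrite linearB addrA subrK.
apply: le_lt_trans (ler_normD _ _) _; have -> : e = e / 2 + e / 2 by field.
apply: ltr_leD; first by apply: hd; rewrite // subrr normr0.
apply: le_trans (W_le _ st') _; rewrite -ler_pdivlMl // mulrC ltW //.
Qed.

Section Trajectory.
Variables (t0 : R) (u : R -> U).
Hypothesis t00 : 0 <= t0.
Hypothesis uPC : PC u.

Notation integrand t phi := (fun s => W t s (Psi s (phi s) (u s))).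

(** The input value [v] is free: [v = u s] yields the right limit of the integrand, and the left
    limit of [u] yields its left limit. *)
Lemma integrand_near (phi : R -> X) t s (v : U) e :
  {within [set r | t0 <= r], continuous phi} -> t0 <= s <= t -> 0 < e ->
  exists2 d, 0 < d & forall s', `|s - s'| < d -> t0 <= s' <= t -> `|v - u s'| < d ->
    `|W t s (Psi s (phi s) v) - integrand t phi s'| < e.
Proof.
move=> /within_continuousP cphi /andP[ts st] e0.
have s0 := le_trans t00 ts.
have [|d1 d10 H1] := @evol_app_eps t s (Psi s (phi s) v) e _ e0; first by rewrite s0.
have [d2 d20 H2] := @H1_continuous_eps s (phi s) v d1 s0 d10.
have [d3 d30 H3] := cphi s ts d2 d20.
exists (Num.min d1 (Num.min d2 d3)); first by rewrite !lt_min d10 d20.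
move=> s'; rewrite !lt_min => /and3P[a1 a2 a3] /andP[ts' st'] /and3P[b1 b2 b3].
have s'0 := le_trans t00 ts'.
apply: H1 => //; first by rewrite s'0.
by apply: H2 => //; exact: H3.
Qed.

Lemma integrand_is_RInt (phi : R -> X) a t :
  {within [set r | t0 <= r], continuous phi} -> t0 <= a -> a <= t ->
  exists I, is_RInt (integrand t phi) a t I.
Proof.
move=> cphi t0a at_; case: uPC => _ [ur [_ ul]]; apply: regulated_is_RInt => //.
- move=> s /andP[as_ st]; exists (W t s (Psi s (phi s) (u s))) => e e0.
  have t0s := le_trans t0a as_.
  have [|d d0 hd] := @integrand_near phi t s (u s) e cphi _ e0.
    by rewrite t0s ltW.
  have /cvgrPdist_lt/(_ d d0) := ur s (le_trans t00 t0s).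
  rewrite near_withinE => /nbhs_ballP[d1 /= d10 hd1].
  exists (Num.min d d1); first by rewrite lt_min d0.
  move=> r /andP[sr rs] rt; rewrite distrC ltW //.
  have srd : `|s - r| < Num.min d d1.
    by rewrite distrC gtr0_norm ?subr_gt0 // ltrBlDl.
  move: srd; rewrite lt_min => /andP[r1 r2].
  by apply: hd => //; [rewrite (le_trans t0s (ltW sr))|apply: hd1].
- move=> s /andP[as_ st].
  have t0s := le_lt_trans t0a as_; have s0 := le_lt_trans t00 t0s.
  have [l hl] := ul s s0; exists (W t s (Psi s (phi s) l)) => e e0.
  have [|d d0 hd] := @integrand_near phi t s l e cphi _ e0.
    by rewrite st (ltW t0s).
  have /cvgrPdist_lt/(_ d d0) := hl.
  rewrite near_withinE => /nbhs_ballP[d1 /= d10 hd1].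
  exists (Num.min d d1); first by rewrite lt_min d0.
  move=> r /andP[rs sr] ra; rewrite distrC ltW //.
  have srd : `|s - r| < Num.min d d1.
    by rewrite gtr0_norm ?subr_gt0 // ltrBlDl -ltrBlDr.
  move: srd; rewrite lt_min => /andP[r1 r2].
  by apply: hd => //; [rewrite (le_trans t0a ra) (ltW (lt_le_trans sr st))|apply: hd1].
Qed.

End Trajectory.
End MildSolutions.

(** * Global existence by Picard iteration *)

Section Picard.
Context {R : realType} {X U : completeNormedModType R}.
Variables (W : R -> R -> {linear X -> X}) (k w : R) (Psi : R -> X -> U -> X).
Implicit Types (t s r e T : R) (x y z : X).
Hypothesis W_id : forall s, 0 <= s -> forall x, W s s x = x.
Hypothesis W_comp : forall t r s, 0 <= s <= r -> r <= t ->
  forall x, W t s x = W t r (W r s x).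
Hypothesis W_cont : forall x, {within [set q : R * R | 0 <= q.2 <= q.1],
  continuous (fun q : R * R => W q.1 q.2 x)}.
Hypothesis k0 : 0 < k.
Hypothesis w0 : 0 < w.
Hypothesis W_stab : forall t s x, 0 <= s <= t ->
  `|W t s x| <= k * expR (- w * (t - s)) * `|x|.
Hypothesis Psi_H1 : H1 Psi.
Variables (t0 : R) (x0 : X) (u : R -> U) (P : R).
Hypothesis t00 : 0 <= t0.
Hypothesis uPC : PC u.
Hypothesis P0 : 0 < P.
Hypothesis Psi_growth : forall s y, 0 <= s -> `|Psi s y (u s)| <= P * (1 + `|y|).

Let W_le t s x : 0 <= s <= t -> `|W t s x| <= k * `|x|.
Proof. by move=> h; exact: (evol_norm_le k0 w0 W_stab). Qed.

Notation integrand t phi := (fun s => W t s (Psi s (phi s) (u s))).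
Notation cont phi := {within [set r | t0 <= r], continuous phi}.

Let ig (phi : R -> X) a t : cont phi -> t0 <= a -> a <= t ->
  exists I, is_RInt (integrand t phi) a t I.
Proof. exact: (integrand_is_RInt W_cont k0 w0 W_stab Psi_H1 t00 uPC). Qed.

(** The default 0 is returned only where no integral exists, which [duhamelP] excludes for
    continuous [phi] and t >= t0. *)
Definition duhamel (phi : R -> X) t : X :=
  xget 0 [set I | is_RInt (integrand t phi) t0 t I].

Definition picard (phi : R -> X) t : X := W t t0 x0 + duhamel phi t.

Lemma duhamelP (phi : R -> X) t : cont phi -> t0 <= t ->
  is_RInt (integrand t phi) t0 t (duhamel phi t).
Proof.
move=> cphi t0t; apply: (@xgetPex _ 0 [set I | is_RInt (integrand t phi) t0 t I]).
exact: ig.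
Qed.

(** The [+ 1] keeps the bound at least 1, so P (1 + |phi|) is at most 2P times the bound; c = 2kP
    then makes the derivative of the bound dominate the integrand, and the Picard map preserves the
    bound. *)
Let a : R := k * `|x0| + 1.
Let c : R := 2 * (k * P).
Definition picard_bound t : R := a * expR (c * (t - t0)).

Let a1 : 1 <= a. Proof. by rewrite lerDr mulr_ge0 // ltW. Qed.
Let a0 : 0 <= a. Proof. exact: le_trans a1. Qed.
Let c0 : 0 < c. Proof. by rewrite !mulr_gt0. Qed.

Lemma picard_bound_ge1 t : t0 <= t -> 1 <= picard_bound t.
Proof.
move=> tt; apply: (le_trans a1); rewrite /picard_bound ler_peMr //.
by rewrite -expR0 ler_expR mulr_ge0 ?(ltW c0) // subr_ge0.
Qed.

Lemma picard_bound_le s t : s <= t -> picard_bound s <= picard_bound t.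
Proof.
by move=> st; rewrite ler_wpM2l // ler_expR ler_wpM2l ?(ltW c0) // lerB.
Qed.

Definition admissible (phi : R -> X) :=
  cont phi /\ forall t, t0 <= t -> `|phi t| <= picard_bound t.

Lemma picard_norm_le (phi : R -> X) t : admissible phi -> t0 <= t ->
  `|picard phi t| <= picard_bound t.
Proof.
move=> [cphi bphi] t0t; apply: le_trans (ler_normD _ _) _.
have h1 : `|W t t0 x0| <= k * `|x0| by apply: W_le; rewrite t00.
have h2 : `|duhamel phi t| <= a * expR (c * (t - t0)) - a * expR (c * (t0 - t0)).
  apply: (is_RInt_norm_le_exp t0t a0 (duhamelP cphi t0t)) => s /andP[s1 s2].
  have s0 := le_trans t00 s1.
  apply: le_trans (W_le _ _) _; first by rewrite s0.
  have b1 := picard_bound_ge1 s1; have b2 := bphi s s1.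
  have -> : c * (a * expR (c * (s - t0))) = k * (P * (2 * picard_bound s)).
    by rewrite /c /picard_bound; ring.
  rewrite ler_wpM2l ?(ltW k0) //; apply: le_trans (Psi_growth _ s0) _.
  rewrite ler_wpM2l ?(ltW P0) //; lra.
apply: le_trans (lerD h1 h2) _; rewrite subrr mulr0 expR0 mulr1 /picard_bound /a.
by rewrite addrCA gerDl subr_le0 lerDl.
Qed.

(** By the cocycle law the integral over [t0, r] is [W t r] applied to the earlier Duhamel term;
    what remains is an integral over [r, t]. *)
Lemma duhamel_cell (phi : R -> X) r t T : admissible phi -> t0 <= r -> r <= t -> t <= T ->
  `|duhamel phi t - W t r (duhamel phi r)| <= k * (P * (2 * picard_bound T)) * (t - r).
Proof.
move=> [cphi bphi] t0r rt tT.
have r0 := le_trans t00 t0r.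
have [J HJ] := ig cphi t0r rt.
have rt' : 0 <= r <= t by rewrite r0.
have HI := is_RInt_linear (fun x => @W_le t r x rt') (duhamelP cphi t0r).
have {}HI : is_RInt (integrand t phi) t0 r (W t r (duhamel phi r)).
  apply: is_RInt_ext HI => s /andP[s1 s2].
  by rewrite -W_comp // (le_trans t00 s1).
have -> := is_RInt_chasles t0r rt HI HJ (duhamelP cphi (le_trans t0r rt)).
rewrite addrAC subrr add0r; apply: (is_RInt_norm_le_cst rt HJ) => s /andP[s1 s2].
have s0 := le_trans r0 s1; have t0s := le_trans t0r s1.
apply: le_trans (W_le _ _) _; first by rewrite s0.
rewrite ler_wpM2l ?(ltW k0) //; apply: le_trans (Psi_growth _ s0) _.
rewrite ler_wpM2l ?(ltW P0) //.
have b1 := picard_bound_ge1 t0s; have b2 := bphi s t0s.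
have := picard_bound_le (le_trans s2 tT); lra.
Qed.

(** The integrand itself depends on the end time through W(t,s), with no uniformity in s at hand.
    Comparing both end times with a common earlier [r] reduces this to strong continuity at the
    single vector [duhamel phi r]. *)
Lemma duhamel_continuous (phi : R -> X) : admissible phi -> cont (duhamel phi).
Proof.
move=> aphi; apply/within_continuousP => t /= t0t e e0.
pose K := k * (P * (2 * picard_bound (t + 1))).
have t0t1 : t0 <= t + 1 by rewrite (le_trans t0t) // lerDl.
have K0 : 0 < K.
  have := picard_bound_ge1 t0t1 => h.
  by do 3! (apply: mulr_gt0 => //); exact: lt_le_trans h.
(* The interval [r, t] has length at most [h] and [r, s] at most [2 * h]: they cost e/4 and e/2, and
   the last e/4 is left for moving [W]. *)
pose h := e / (4 * K).
have h0 : 0 < h by apply: divr_gt0 => //; apply: mulr_gt0.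
have hK : K * h = e / 4 by rewrite /h; field; rewrite gt_eqF.
clearbody h.
pose r := Num.max t0 (t - h).
have t0r : t0 <= r by rewrite le_max lexx.
have rt : r <= t by rewrite ge_max t0t gerBl ltW.
have htr : t - r <= h by rewrite lerBlDr -lerBlDl le_max lexx orbT.
have e4 : 0 < e / 4 by rewrite divr_gt0.
have r0 := le_trans t00 t0r.
have [|d1 d10 H1] := @evol_continuous_eps R X W W_cont (duhamel phi r) t r (e / 4) _ e4.
  by rewrite r0.
exists (Num.min 1 (Num.min d1 h)); first by rewrite !lt_min ltr01 d10.
  move=> s /= t0s; rewrite -ball_normE /= !lt_min => /and3P[s1 s2 s3].
  have rs : r <= s 
    by rewrite ge_max t0s; move: s3; rewrite ltr_norml => /andP[_ s3]; lra.
  have st1 : s <= t + 1 by move: s1; rewrite ltr_norml => /andP[s1 _]; lra.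
  have tt1 : t <= t + 1 by rewrite lerDl.
  have c1 := duhamel_cell aphi t0r rt tt1.
  have c2 := duhamel_cell aphi t0r rs st1.
  have c3 : `|W t r (duhamel phi r) - W s r (duhamel phi r)| < e / 4.
    by apply: H1 => //; [rewrite r0|rewrite subrr normr0].
  rewrite -/K in c1 c2.
  have c1' : K * (t - r) <= e / 4 by rewrite -hK ler_wpM2l // ltW.
  have c2' : K * (s - r) <= 2 * (e / 4).
    have -> : 2 * (e / 4) = K * (2 * h) by rewrite -hK; ring.
    rewrite ler_wpM2l ?(ltW K0) //.
    by move: s3; rewrite ltr_norml => /andP[s3 _]; lra.
  have -> : duhamel phi t - duhamel phi s = (duhamel phi t - W t r (duhamel phi r)) +
     (W t r (duhamel phi r) - W s r (duhamel phi r)) - (duhamel phi s - W s r (duhamel phi r)).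
    by rewrite addrA subrK opprB addrA subrK.
  apply: le_lt_trans (ler_normB _ _) _.
  have := ler_normD (duhamel phi t - W t r (duhamel phi r)) (W t r (duhamel phi r) - W s r (duhamel phi r)).
  move: `|_| `|_| `|_| `|_| (K * _) (K * _) c1 c2 c3 c1' c2' => *; lra.
Qed.

Lemma picard_continuous (phi : R -> X) : admissible phi -> cont (picard phi).
Proof.
move=> aphi; apply/within_continuousP => t /= t0t e e0.
have /within_continuousP h1 := @evol_continuous_to R X W W_cont x0 t0 t00.
have /within_continuousP h2 := @duhamel_continuous phi aphi.
have e2 : 0 < e / 2 by rewrite divr_gt0.
have [d1 d10 H1] := h1 t t0t _ e2; have [d2 d20 H2] := h2 t t0t _ e2.
exists (Num.min d1 d2); first by rewrite lt_min d10.
move=> s t0s; rewrite -ball_normE /= lt_min => /andP[s1 s2].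
rewrite /picard opprD addrACA; apply: le_lt_trans (ler_normD _ _) _.
have -> : e = e / 2 + e / 2 by field.
by apply: ltrD; [apply: H1|apply: H2] => //; rewrite -ball_normE.
Qed.

Lemma picard_admissible (phi : R -> X) : admissible phi -> admissible (picard phi).
Proof. by move=> aphi; split; [exact: picard_continuous|move=> t; exact: picard_norm_le]. Qed.

(** Admissible functions share one ball on [t0, T], hence one Lipschitz constant [L]. In the norm
    weighted by e^{-q(s - t0)} with q = 2kL, integration gains kL/q = 1/2. *)
Lemma picard_contraction T : t0 <= T -> exists2 q, 0 <= q &
  forall (phi psi : R -> X) D, admissible phi -> admissible psi -> 0 <= D ->
  (forall s, t0 <= s <= T -> `|phi s - psi s| <= D * expR (q * (s - t0))) ->
  forall t, t0 <= t <= T -> `|picard phi t - picard psi t| <= D / 2 * expR (q * (t - t0)).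
Proof.
move=> t0T; have [[cu hu] _] := uPC; case: (Psi_H1) => _ Plip.
(* One radius for [phi], [psi] and the input; the horizon below is [T + 1] because [H1] asks for a
   positive one and [T] may be 0. *)
pose C := picard_bound T + `|cu| + 1; have b1 := picard_bound_ge1 t0T.
have cu0 := normr_ge0 cu.
have C0 : 0 < C by rewrite /C; lra.
have T10 : 0 < T + 1 by move: t00 t0T; lra.
have [L [L0 HL]] := Plip C (T + 1) C0 T10.
exists (2 * (k * L)); first by rewrite !mulr_ge0 // ltW.
move=> phi psi D [cphi bphi] [cpsi bpsi] D0 hD t /andP[t0t tT].
have -> : picard phi t - picard psi t = duhamel phi t + (-1) *: duhamel psi t.
  by rewrite /picard opprD addrACA subrr add0r scaleN1r.
have HI := is_RInt_lin (-1) (duhamelP cphi t0t) (duhamelP cpsi t0t).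
set q := 2 * (k * L).
have D20 : 0 <= D / 2 by rewrite divr_ge0.
have := @is_RInt_norm_le_exp _ _ _ _ _ t0 q (D / 2) _ t0t D20 HI.
move=> H; apply: le_trans (H _) _; last first.
  by rewrite gerBl mulr_ge0 // expR_ge0.
move=> s /andP[s1 s2]; have s0 := le_trans t00 s1.
rewrite scaleN1r -linearB; apply: le_trans (W_le _ _) _; first by rewrite s0.
have -> : q * (D / 2 * expR (q * (s - t0))) = k * (L * (D * expR (q * (s - t0)))).
  by move: (expR _) => z; rewrite /q; field.
rewrite ler_wpM2l ?(ltW k0) //.
have sT := le_trans s2 tT.
have hs : t0 <= s <= T by rewrite s1.
have p1 := bphi s s1; have p2 := bpsi s s1; have p3 := picard_bound_le sT.
have p4 := le_trans (hu s s0) (ler_norm cu).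
apply: (@le_trans _ _ (L * `|phi s - psi s|)); last by rewrite ler_wpM2l ?(ltW L0) // hD.
apply: HL; rewrite /C; [by rewrite s0; lra|lra|lra|lra].
Qed.

Definition picard_iter n : R -> X := iter n picard (fun=> 0).

Lemma picard_iter_admissible n : admissible (picard_iter n).
Proof.
elim: n => [|n IH]; last exact: picard_admissible.
split; first by apply: continuous_subspaceT => t; exact: cvg_cst.
by move=> t t0t; rewrite normr0 (le_trans _ (picard_bound_ge1 t0t)).
Qed.

Definition picard_lim t : X := lim ((fun n => picard_iter n t) @ \oo).

Lemma picard_lim_le T : t0 <= T -> exists D q, [/\ 0 <= D, 0 <= q &
  forall n t, t0 <= t <= T ->
    `|picard_lim t - picard_iter n t| <= D / 2 ^+ n * expR (q * (t - t0))].
Proof.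
move=> t0T; have [q q0 hq] := picard_contraction t0T.
pose D := picard_bound T.
have D0 : 0 <= D by apply: le_trans (picard_bound_ge1 t0T).
have h n t : t0 <= t <= T ->
    `|picard_iter n.+1 t - picard_iter n t| <= D / 2 ^+ n * expR (q * (t - t0)).
  elim: n t => [|n IH] t ht.
    rewrite /= subr0 expr0 divr1; case/andP: ht => t0t tT.
    apply: le_trans ((picard_iter_admissible 1).2 t t0t) _.
    apply: le_trans (picard_bound_le tT) _; rewrite ler_peMr //.
    by rewrite -expR0 ler_expR mulr_ge0 // subr_ge0.
  have -> : D / 2 ^+ n.+1 = D / 2 ^+ n / 2 by rewrite exprS invfM mulrA mulrAC.
  apply: (hq (picard_iter n.+1) (picard_iter n)) => //;
    [exact: (picard_iter_admissible n.+1)|exact: picard_iter_admissible|].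
  by rewrite divr_ge0 // exprn_ge0.
exists (2 * D), q; split; [by rewrite mulr_ge0|by []|].
move=> n t ht.
have H m : `|picard_iter m.+1 t - picard_iter m t| <= D * expR (q * (t - t0)) / 2 ^+ m.
  by rewrite mulrAC; exact: h.
apply: le_trans (geometric_cvg (z := fun n => picard_iter n t) H n) _.
by rewrite mulrA mulrAC.
Qed.

Lemma picard_lim_admissible : admissible picard_lim.
Proof.
split.
  apply/within_continuousP => t /= t0t e e0.
  have t0t1 : t0 <= t + 1 by rewrite (le_trans t0t) // lerDl.
  have [D [q [D0 q0 hD]]] := picard_lim_le t0t1.
  have e3 : 0 < e / 3 by rewrite divr_gt0.
  have [n hn] := geometric_small (D * expR (q * (t + 1 - t0))) e3.
  have [cn _] := picard_iter_admissible n.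
  have /within_continuousP h1 := cn.
  have [d d0 hd] := h1 t t0t _ e3.
  exists (Num.min 1 d); first by rewrite lt_min ltr01.
  move=> s t0s; rewrite -ball_normE /= lt_min => /andP[s1 s2].
  have hb r : t0 <= r <= t + 1 -> `|picard_lim r - picard_iter n r| < e / 3.
    move=> hr; apply: le_lt_trans (hD n r hr) _; apply: le_lt_trans hn.
    rewrite mulrAC ler_wpM2r ?invr_ge0 ?exprn_ge0 // ler_wpM2l // ler_expR ler_wpM2l //.
    by rewrite lerB //; case/andP: hr.
  have -> : picard_lim t - picard_lim s = (picard_lim t - picard_iter n t) +
     (picard_iter n t - picard_iter n s) - (picard_lim s - picard_iter n s).
    by rewrite addrA subrK opprB addrA subrK.
  apply: le_lt_trans (ler_normB _ _) _.
  have c1 : `|picard_lim t - picard_iter n t| < e / 3 by apply: hb; rewrite t0t lerDl ler01.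
  have c2 : `|picard_lim s - picard_iter n s| < e / 3.
    apply: hb; rewrite [t0 <= s]t0s /=.
    by move: s1; rewrite ltr_norml => /andP[s1 _]; lra.
  have c3 : `|picard_iter n t - picard_iter n s| < e / 3.
    by apply: hd => //; rewrite -ball_normE.
  have := ler_normD (picard_lim t - picard_iter n t) (picard_iter n t - picard_iter n s).
  by move: c1 c2 c3; move: `|_| `|_| `|_| `|_| => ? ? ? ?; lra.
move=> t t0t; apply/ler_addgt0Pr => e e0.
have [D [q [D0 q0 hD]]] := picard_lim_le t0t.
have [n hn] := geometric_small (D * expR (q * (t - t0))) e0.
have := (picard_iter_admissible n).2 t t0t => h2.
rewrite -[picard_lim t](subrK (picard_iter n t)) addrC.
apply: le_trans (ler_normD _ _) _; apply: lerD => //.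
have tt : t0 <= t <= t by rewrite t0t lexx.
apply: le_trans (hD n t tt) _; apply: le_trans (ltW hn).
by rewrite mulrAC.
Qed.

Lemma picard_lim_fixed t : t0 <= t -> picard picard_lim t = picard_lim t.
Proof.
move=> t0t; apply/eqP; rewrite -subr_eq0 -normr_le0; apply/ler_addgt0Pr => e e0.
rewrite add0r.
have [D [q [D0 q0 hD]]] := picard_lim_le t0t.
have [q' q'0 hq] := picard_contraction t0t.
have tt : t0 <= t <= t by rewrite t0t lexx.
pose E := D * expR (q * (t - t0)).
have E0 : 0 <= E by rewrite mulr_ge0 ?expR_ge0.
pose F := E + E * expR (q' * (t - t0)).
have [n hn] := geometric_small F e0.
have n20 : 0 < 2 ^+ n :> R by rewrite exprn_gt0.
have h1 : `|picard_lim t - picard_iter n.+1 t| <= E / 2 ^+ n.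
  apply: le_trans (hD n.+1 t tt) _; rewrite mulrAC -/E ler_wpM2l //.
  by rewrite lef_pV2 ?posrE ?exprn_gt0 // exprS ler_peMl ?(ltW n20) // ler1n.
(* [q'] need not equal [q]: the distance is first bounded by a constant on [t0, t], then the new
   weight, which is at least 1, is attached. *)
have h2 s : t0 <= s <= t ->
    `|picard_lim s - picard_iter n s| <= E / 2 ^+ n * expR (q' * (s - t0)).
  move=> /andP[s1 s2]; apply: le_trans (hD n s _) _; first by rewrite s1.
  rewrite mulrAC -[leLHS]mulr1; apply: ler_pM => //.
  - by rewrite divr_ge0 ?mulr_ge0 ?expR_ge0 ?(ltW n20).
  - by rewrite ler_wpM2r ?invr_ge0 ?(ltW n20) // ler_wpM2l // ler_expR ler_wpM2l // lerB.
  - by rewrite -expR0 ler_expR mulr_ge0 // subr_ge0.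
have E2 : 0 <= E / 2 ^+ n by rewrite divr_ge0 // ltW.
have h3 := hq _ _ _ picard_lim_admissible (picard_iter_admissible n) E2 h2 t tt.
have -> : picard picard_lim t - picard_lim t =
   (picard picard_lim t - picard_iter n.+1 t) - (picard_lim t - picard_iter n.+1 t).
  by rewrite opprB addrA subrK.
apply: le_trans (ler_normB _ _) _; apply: le_trans (lerD h3 h1) _.
apply: le_trans (ltW hn).
rewrite /F mulrDl addrC lerD2l [leRHS]mulrAC ler_wpM2r ?expR_ge0 //.
by rewrite ler_piMr // invf_le1 // ler1n.
Qed.

Lemma picard_lim_mild_sol : mild_sol W Psi t0 x0 u +oo%E picard_lim.
Proof.
have [cl _] := picard_lim_admissible; split.
  by rewrite (_ : [set t | _] = [set r | t0 <= r]) //; apply/seteqP; split => r /= [] //;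
    split=> //; rewrite ltry.
move=> t t0t _; rewrite -(picard_lim_fixed t0t) /picard addrAC subrr add0r.
exact: duhamelP.
Qed.

End Picard.

(** * Dini derivative of ln(1 + V) along a mild solution *)

Section LieDerivative.
Context {R : realType} {X U : completeNormedModType R}.
Variables (W : R -> R -> {linear X -> X}) (k w : R) (Psi : R -> X -> U -> X).
Implicit Types (t s r e : R) (x y z : X).
Hypothesis W_id : forall s, 0 <= s -> forall x, W s s x = x.
Hypothesis W_comp : forall t r s, 0 <= s <= r -> r <= t ->
  forall x, W t s x = W t r (W r s x).
Hypothesis W_cont : forall x, {within [set q : R * R | 0 <= q.2 <= q.1],
  continuous (fun q : R * R => W q.1 q.2 x)}.
Hypothesis k0 : 0 < k.
Hypothesis w0 : 0 < w.
Hypothesis W_stab : forall t s x, 0 <= s <= t ->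
  `|W t s x| <= k * expR (- w * (t - s)) * `|x|.
Hypothesis Psi_H1 : H1 Psi.
Variables (t : R) (x : X) (u : R -> U) (T : \bar R) (phi : R -> X).
Hypothesis t0 : 0 <= t.
Hypothesis tT : (t%:E < T)%E.
Hypothesis uPC : PC u.
Hypothesis phi_sol : mild_sol W Psi t x u T phi.

Let W_le r s y : 0 <= s <= r -> `|W r s y| <= k * `|y|.
Proof. by move=> h; exact: (evol_norm_le k0 w0 W_stab). Qed.

(** Not a clause of [mild_sol]: it comes from the formula at the initial time, where the integral
    over a single point can only be 0. *)
Lemma mild_sol_init : phi t = x.
Proof.
have [_ /(_ t (lexx t) tT) HI] := phi_sol.
have := is_RInt_unique (lexx t) HI (@is_RInt_refl _ _ _ t).
by move/eqP; rewrite subr_eq0 W_id // => /eqP.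
Qed.

Lemma mild_sol_lifetime : exists2 d, 0 < d & forall s, s < t + d -> (s%:E < T)%E.
Proof.
case: (T) tT => [r|_|//]; last by exists 1 => // s _; rewrite ltry.
rewrite lte_fin => tr; exists (r - t); first by rewrite subr_gt0.
by move=> s; rewrite lte_fin addrC subrK.
Qed.

(** Right-continuity of [u] makes the single value [u t] govern the integrand over a short interval
    after [t]. *)
Lemma mild_sol_increment e : 0 < e -> exists2 d, 0 < d & forall h, 0 < h -> h < d ->
  `|phi (t + h) - W (t + h) t x| <= k * (`|Psi t x (u t)| + e) * h.
Proof.
move=> e0; have [cphi sphi] := phi_sol; have [_ [ur _]] := uPC.
have [d1 d10 hT] := mild_sol_lifetime.
have [d2 d20 hP] := H1_continuous_eps Psi_H1 x (u t) t0 e0.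
have /within_continuousP hphi := cphi.
have [|d3 d30 h3] := hphi t _ d2 d20; first by rewrite /= lexx.
have /cvgrPdist_lt/(_ d2 d20) := ur t t0.
rewrite near_withinE => /nbhs_ballP[d4 /= d40 h4].
exists (Num.min (Num.min d1 d2) (Num.min d3 d4)); first by rewrite !lt_min d10 d20 d30.
move=> h h0; rewrite !lt_min => /andP[/andP[hd1 hd2] /andP[hd3 hd4]].
have tth : t <= t + h by rewrite lerDl ltW.
have HI := sphi (t + h) tth (hT _ _); rewrite ltrD2l in HI.
have := is_RInt_norm_le_cst tth (HI hd1) (N := k * (`|Psi t x (u t)| + e)).
have -> : t + h - t = h by rewrite addrAC subrr add0r.
apply=> s /andP[ts sh]; have s0 := le_trans t0 ts.
have dts : `|t - s| <= h by rewrite distrC ger0_norm ?subr_ge0 // lerBlDl.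
apply: le_trans (W_le _ _) _; first by rewrite s0.
rewrite ler_wpM2l ?(ltW k0) //.
have : `|Psi t x (u t) - Psi s (phi s) (u s)| < e.
  apply: hP => //; first exact: le_lt_trans hd2.
    rewrite -mild_sol_init; apply: h3.
      by split=> //; apply: hT; apply: le_lt_trans sh _; rewrite ltrD2l.
    by rewrite -ball_normE /=; apply: le_lt_trans hd3.
  move: ts; rewrite le_eqVlt => /predU1P[<-|ts]; first by rewrite subrr normr0.
  by apply: h4 => //; apply: le_lt_trans hd4.
move=> hlt; rewrite -[Psi s _ _](subKr (Psi t x (u t))).
by apply: le_trans (ler_normB _ _) _; rewrite lerD2l ltW.
Qed.

(** This is ln z <= z - 1 at z = (1 + a)/(1 + b). It passes from V to Z at the level of increments,
    so no chain rule for Dini derivatives is needed. *)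
Lemma ln1D_sub_le (a b : R) : 0 <= a -> 0 <= b -> ln (1 + a) - ln (1 + b) <= (a - b) / (1 + b).
Proof.
move=> a0 b0; have b1 : 0 < 1 + b by rewrite ltr_wpDr.
have a1 : 0 < 1 + a by rewrite ltr_wpDr.
rewrite -ln_div ?posrE //.
have -> : (1 + a) / (1 + b) = 1 + (a - b) / (1 + b) by field; rewrite gt_eqF.
apply: le_ln1Dx; rewrite ltr_pdivlMr // mulN1r; lra.
Qed.

Notation c2 := (vcst k w).
Notation P := `|Psi t x (u t)|.

Lemma Vfun_increment e : 0 < e -> e <= 1 -> exists2 d, 0 < d & forall h, 0 < h -> h < d ->
  Vfun W (t + h) (phi (t + h)) - Vfun W t x <=
  (- `|x| ^+ 2 + 2 * c2 * k ^+ 2 * `|x| * P +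
   e * (1 + c2 * k * (2 * k * `|x| + P + 1))) * h.
Proof.
move=> e0 e1; have [d1 d10 H1] := mild_sol_increment e0.
have [d2 d20 H2] := @Rintegral_evol_sqr_ge _ _ _ _ _ W_id W_cont k0 w0 W_stab x t e t0 e0.
have kP : 0 < k * (P + e) by rewrite mulr_gt0 // ltr_wpDl.
(* The third radius makes the deviation [D] from the free motion at most [e], which bounds the sum
   of norms in [Vfun_dist]. *)
exists (Num.min d1 (Num.min d2 (e / (k * (P + e))))).
  by rewrite !lt_min d10 d20 divr_gt0.
move=> h h0; rewrite !lt_min => /and3P[hd1 hd2 hd3].
have tth : t <= t + h by rewrite lerDl ltW.
have th0 := le_trans t0 tth.
rewrite (Vfun_split W_comp W_cont k0 w0 W_stab x t0 tth).
have := H1 h h0 hd1; set D := `|_ - _| => hD.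
have De : D <= e.
  apply: le_trans hD _; rewrite ltr_pdivlMr // in hd3.
  by rewrite mulrC ltW.
have := H2 (t + h) tth; rewrite ltrD2l => /(_ hd2).
rewrite [_ - t]addrAC subrr add0r; set J := \int[_]_(_ in _) _ => hJ.
have := Vfun_dist W_cont k0 w0 W_stab (phi (t + h)) (W (t + h) t x) th0.
rewrite -/D; have := W_le x (_ : 0 <= t <= t + h); rewrite t0 tth => /(_ isT) hW.
have hphi : `|phi (t + h)| <= D + `|W (t + h) t x|.
  by rewrite -{1}[phi _](subrK (W (t + h) t x)) ler_normD.
have c20 : 0 < c2 by exact: vcst_gt0.
have D0 : 0 <= D by exact: normr_ge0.
move=> hV.
have {}hV : Vfun W (t + h) (phi (t + h)) - Vfun W (t + h) (W (t + h) t x) <=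
    c2 * (k * (P + e) * h) * (2 * (k * `|x|) + e).
  apply: le_trans (ler_norm _) _; apply: le_trans hV _.
  apply: ler_pM; [by rewrite mulr_ge0 // ltW|by rewrite addr_ge0| |].
    by rewrite ler_wpM2l // ltW.
  by move: hphi hW De; move: `|phi _| `|W _ _ _| (k * `|x|) (D) => ? ? ? ?; lra.
rewrite opprD addrA addrAC; apply: le_trans (lerB hV hJ) _.
rewrite -subr_ge0.
have xx0 := normr_ge0 x; have P0 : 0 <= P by [].
move: `|x| P xx0 P0 kP => a p a0 p0 kp.
(* The claimed bound exceeds the one obtained by exactly c2 k h e (1 - e); this is where [e <= 1]
   enters. *)
have -> : (- a ^+ 2 + 2 * c2 * k ^+ 2 * a * p + e * (1 + c2 * k * (2 * k * a + p + 1))) * h -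
  (c2 * (k * (p + e) * h) * (2 * (k * a) + e) - (a ^+ 2 - e) * h) =
  c2 * k * h * (e * (1 - e)) by ring.
apply: mulr_ge0; last by apply: mulr_ge0; [exact: ltW|rewrite subr_ge0].
by apply: mulr_ge0; [apply: mulr_ge0|]; exact: ltW.
Qed.

Lemma lie_deriv_le : (lie_deriv (fun s y => ln (1 + Vfun W s y)) t x phi <=
  ((- `|x| ^+ 2 + 2 * c2 * k ^+ 2 * `|x| * P) / (1 + Vfun W t x))%:E)%E.
Proof.
apply/lee_addgt0Pr => e e0.
have V0 : 0 <= Vfun W t x by exact: Vfun_ge0.
have V1 : 0 < 1 + Vfun W t x by rewrite ltr_wpDr.
pose C := 1 + c2 * k * (2 * k * `|x| + P + 1).
have C0 : 0 < C.
  apply: ltr_wpDr => //; apply: mulr_ge0.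
    by apply: mulr_ge0; apply: ltW => //; exact: vcst_gt0.
  do 2! (apply: addr_ge0 => //); do 2! (apply: mulr_ge0 => //); exact: ltW.
(* [C] is the factor of the error in [Vfun_increment]. The error becomes at most [e], and dividing
   by 1 + V >= 1 does not enlarge it. *)
have [||d d0 hd] := @Vfun_increment (Num.min 1 (e / C)).
- by rewrite lt_min ltr01 divr_gt0.
- by rewrite ge_min lexx.
rewrite /lie_deriv limf_esupE; set f := (fun h : R => _%:E).
(* The limsup is an infimum of suprema over neighbourhoods, so the single neighbourhood (0, d)
   bounds it from above. *)
apply: (@le_trans _ _ (ereal_sup (f @` [set h | 0 < h < d]))).
  apply: ereal_inf_lbound; exists [set h | 0 < h < d] => //.
  rewrite /at_right /= /within /=; apply/nbhs_ballP; exists d => // h.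
  rewrite -ball_normE /= sub0r normrN => h1 h2 /=.
  by rewrite h2; apply: le_lt_trans (ler_norm h) h1.
apply: ub_ereal_sup => _ [h /= /andP[h0 hd'] <-].
rewrite -EFinD lee_fin ler_pdivrMl //.
apply: le_trans (ln1D_sub_le (Vfun_ge0 _ _ _) V0) _.
rewrite ler_pdivrMr //; apply: le_trans (hd h h0 hd') _; rewrite -/C.
rewrite [leLHS]mulrC -[leRHS]mulrA ler_wpM2l ?(ltW h0) // [leRHS]mulrDl divfK ?gt_eqF // lerD2l.
apply: (@le_trans _ _ e); last by rewrite ler_peMr ?(ltW e0) // lerDl.
by rewrite -ler_pdivlMr // ge_min lexx orbT.
Qed.

End LieDerivative.

(** * The comparison functions of the Lyapunov and iISS estimates *)

Section ComparisonFunctions.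
Context {R : realType}.
Implicit Types (r c : R).

Lemma class_K_comb (del : R -> R) (a b : R) : 0 < a -> 0 <= b -> class_K del ->
  class_K (fun r => a * r + b * del r).
Proof.
move=> a0 b0 [/subspace_continuousP cd [d0 hd]]; split; last split.
- apply/subspace_continuousP => x Ax; apply: cvgD; apply: cvgMr; last exact: cd.
  exact: cvg_within.
- by rewrite d0 !mulr0 addr0.
- move=> r s r0 rs; apply: ltr_leD; first by rewrite ltr_pM2l.
  by rewrite ler_wpM2l // ltW // hd.
Qed.

Lemma class_Kinf_ln c : 0 < c -> class_Kinf (fun r : R => ln (1 + c * r ^+ 2)).
Proof.
move=> c0; have pos r : 0 < 1 + c * r ^+ 2.
  by rewrite ltr_wpDr // mulr_ge0 ?sqr_ge0 // ltW.
split; first split; last first.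
- move=> N; have e0 : 0 <= expR N / c by rewrite divr_ge0 ?expR_ge0 // ltW.
  exists (Num.sqrt (expR N / c)); split; first exact: sqrtr_ge0.
  have e1 : 0 < 1 + expR N by rewrite ltr_wpDr ?expR_ge0.
  rewrite sqr_sqrtr // mulrC divfK ?gt_eqF // -[leLHS]expRK ler_ln ?posrE ?expR_gt0 //.
  by rewrite lerDr.
- split; first by rewrite expr0n mulr0 addr0 ln1.
  move=> r s r0 rs; rewrite ltr_ln ?posrE // ltrD2l ltr_pM2l //.
  by rewrite ltr_sqr ?nnegrE ?(le_trans r0 (ltW rs)).
apply: continuous_subspaceT => x; apply: continuous_comp; last exact: continuous_ln.
apply: cvgD; first exact: cvg_cst.
by apply: cvgMr; apply: exprn_continuous.
Qed.

Lemma pos_def_ratio c : 0 < c -> pos_def (fun r : R => r ^+ 2 / (1 + c * r ^+ 2)).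
Proof.
move=> c0; have pos r : 0 < 1 + c * r ^+ 2.
  by rewrite ltr_wpDr // mulr_ge0 ?sqr_ge0 // ltW.
split; last split.
- apply: continuous_subspaceT => x; apply: cvgM; first exact: exprn_continuous.
  apply: cvgV; first by rewrite gt_eqF.
  apply: cvgD; first exact: cvg_cst.
  by apply: cvgMr; apply: exprn_continuous.
- by rewrite expr0n mul0r.
- by move=> r r0; rewrite divr_gt0 ?exprn_gt0.
Qed.

(** The shape of the input part left by [split_product] when [E] and [B] are multiples of the input
    energy [r]. *)
Lemma class_Kinf_exp (c K : R) : 0 < c -> 0 < K ->
  class_Kinf (fun r : R => (expR (c * r) - 1) ^+ 2 / 2 + K * r * expR (c * r)).
Proof.
move=> c0 K0; split; first split; last first.
- move=> N; exists (`|N| / K); split; first by rewrite divr_ge0 // ltW.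
  apply: le_trans (ler_norm N) _; apply: ler_wpDl.
    by rewrite divr_ge0 ?sqr_ge0.
  rewrite mulrC [K * _]mulrC divfK ?gt_eqF // ler_peMl // -expR0 ler_expR.
  by rewrite mulr_ge0 ?(ltW c0) // divr_ge0 // ltW.
- split; first by rewrite !mulr0 expR0 subrr expr0n !mul0r addr0.
  move=> r s r0 rs; have s0 := le_lt_trans r0 rs.
  have e1 : 1 <= expR (c * r) by rewrite -expR0 ler_expR mulr_ge0 // ltW.
  have e2 : expR (c * r) <= expR (c * s) by rewrite ler_expR ler_wpM2l ?ltW.
  apply: ler_ltD.
    rewrite ler_pM2r ?invr_gt0 // ler_sqr ?nnegrE ?lerB // subr_ge0 //.
    exact: le_trans e2.
  apply: (@lt_le_trans _ _ (K * s * expR (c * r))).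
    by rewrite ltr_pM2r ?expR_gt0 // ltr_pM2l.
  by rewrite ler_wpM2l // mulr_ge0 // ltW.
apply: continuous_subspaceT => x.
have ce : expR (c * y) @[y --> x] --> expR (c * x).
  apply: cvg_comp; last exact: continuous_expR.
  by apply: cvgMr; exact: cvg_id.
apply: cvgD.
  apply: cvgMl; rewrite expr2; under eq_fun do rewrite expr2.
  by apply: cvgM; apply: cvgB => //; exact: cvg_cst.
by apply: cvgM => //; apply: cvgMr; exact: cvg_id.
Qed.

(** This is a + a^2/2 with a = k e^{-wt} r, the initial-state part left by [split_product]; [t - 0]
    matches the form of [cvg_exp_shift]. *)
Lemma class_KL_exp (k w : R) : 0 < k -> 0 < w ->
  class_KL (fun r t : R => k * expR (- w * (t - 0)) * r + (k * expR (- w * (t - 0)) * r) ^+ 2 / 2).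
Proof.
move=> k0 w0.
have q0 t : 0 < k * expR (- w * (t - 0)) by rewrite mulr_gt0 ?expR_gt0.
split=> [t t0|r r0].
- move: (q0 t); move: (k * _) => q {}q0; split; last split.
  + apply: continuous_subspaceT => x.
    have cl : q * y @[y --> x] --> q * x by apply: cvgMr; exact: cvg_id.
    apply: cvgD => //; apply: cvgMl; rewrite expr2; under eq_fun do rewrite expr2.
    exact: cvgM.
  + by rewrite mulr0 expr0n mul0r addr0.
  + move=> a b a0 ab; apply: ltrD; first by rewrite ltr_pM2l.
    rewrite ltr_pM2r ?invr_gt0 // ltr_sqr ?nnegrE ?mulr_ge0 ?(ltW q0) //.
      by rewrite ltr_pM2l.
    exact: le_trans (ltW ab).
- split=> [s t s0 st|].
    have h : k * expR (- w * (t - 0)) * r <= k * expR (- w * (s - 0)) * r.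
      rewrite ler_wpM2r // ler_wpM2l ?(ltW k0) // ler_expR.
      by rewrite !mulNr lerN2 ler_wpM2l ?(ltW w0) // lerB.
    apply: lerD => //; rewrite ler_pM2r ?invr_gt0 // ler_sqr ?nnegrE //.
      by rewrite mulr_ge0 // ltW.
    by rewrite mulr_ge0 // ltW.
  have h : k * expR (- w * (t - 0)) * r @[t --> +oo] --> (0 : R).
    rewrite -(mul0r r) -(mulr0 k); apply: cvgMl; apply: cvgMr.
    exact: cvg_exp_shift.
  rewrite -[X in _ --> X](_ : 0 + 0 * 0 / 2 = 0); last by rewrite mul0r mul0r addr0.
  apply: cvgD => //; apply: cvgMl; under eq_fun do rewrite expr2.
  exact: cvgM.
Qed.

(** The two sides differ by the half-square of a - (e^E - 1). *)
Lemma split_product (a E B : R) : 0 <= a ->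
  (a + B) * expR E <= a + a ^+ 2 / 2 + ((expR E - 1) ^+ 2 / 2 + B * expR E).
Proof.
move=> a0; have : 0 <= (a - (expR E - 1)) ^+ 2 by exact: sqr_ge0.
move: (expR E) => z h.
have -> : a + a ^+ 2 / 2 + ((z - 1) ^+ 2 / 2 + B * z) =
  (a + B) * z + (a - (z - 1)) ^+ 2 / 2 by field.
by rewrite lerDl divr_ge0.
Qed.

End ComparisonFunctions.

(** * The integral estimate behind iISS *)

Section InputToState.
Context {R : realType} {X U : completeNormedModType R}.
Notation mu := (@lebesgue_measure R).
Variables (W : R -> R -> {linear X -> X}) (k w : R) (Psi : R -> X -> U -> X).
Variables (b g : R) (del : R -> R).
Implicit Types (t s r e : R) (x y z : X).
Hypothesis k0 : 0 < k.
Hypothesis w0 : 0 < w.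
Hypothesis W_stab : forall t s x, 0 <= s <= t ->
  `|W t s x| <= k * expR (- w * (t - s)) * `|x|.
Hypothesis b0 : 0 < b.
Hypothesis g0 : 0 < g.
Hypothesis delK : class_K del.
Hypothesis Psi_growth : forall s y v, 0 <= s ->
  `|Psi s y v| <= b * `|v| + g * `|y| * del `|v|.
Variables (t0 : R) (x0 : X) (u : R -> U) (phi : R -> X).
Hypothesis t00 : 0 <= t0.
Hypothesis uPC : PC u.
Hypothesis phi_sol : mild_sol W Psi t0 x0 u +oo%E phi.

(** Gronwall's lemma is applied to [Y], the norm multiplied by e^{w(s - t0)}: this weight cancels
    the decay inside the integral, and dividing by it at time [t] restores the decay on the initial
    state. *)
Lemma iISS_estimate t : t0 <= t ->
  `|phi t| <= (k * expR (- w * (t - t0)) * `|x0| +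
    k * b * \int[mu]_(s in `[t0, t]) (`|u s| + del `|u s|)) *
    expR (2 * (k * g) * \int[mu]_(s in `[t0, t]) (`|u s| + del `|u s|)).
Proof.
move=> t0t; have [cphi sphi] := phi_sol; have [[cu hu] _] := uPC.
have del0 (v : U) : 0 <= del `|v| by apply: (class_K_ge0 delK).
have cy : {within `[t0, t], continuous (fun s => `|phi s|)}.
  apply/within_continuousP => s; rewrite /= in_itv /= => /andP[s1 s2] e e0.
  have /within_continuousP h := cphi.
  have [|d d0 hd] := h s _ e e0; first by rewrite /= ltry.
  exists d => // s'; rewrite /= in_itv /= => /andP[s1' s2'] ss'.
  apply: le_lt_trans (hd s' _ ss'); first exact: ler_dist_dist.
  by rewrite /= ltry.
have [m _ hm] := EVT_max t0t cy.
have mphi : measurable_fun `[t0, t] (fun s => `|phi s|).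
  exact: subspace_continuous_measurable_fun.
have mexp : measurable_fun `[t0, t] (fun s => expR (w * (s - t0))).
  apply: measurable_funS (@measurableT _ _) _ _ => //.
  have := @continuous_exp_shift R (- w) t0; rewrite opprK => h.
  exact: continuous_measurable_fun.
have cn : continuous (fun v : U => `|v|) by move=> v; exact: norm_continuous.
have cd : continuous (fun v : U => del `|v|).
  move=> v; rewrite (_ : (fun v : U => del `|v|) =
      (fun r : R => del `|r|) \o (fun v : U => `|v|)).
    by apply: continuous_comp; [exact: cn|exact: (class_K_norm_continuous delK)].
  by apply/funext => y /=; rewrite normr_id.
have mu_ : measurable_fun `[t0, t] (fun s => `|u s|).
  exact: (PC_measurable uPC cn t00).
have mdel : measurable_fun `[t0, t] (fun s => del `|u s|).
  exact: (PC_measurable uPC cd t00).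
have bnd s : t0 <= s <= t -> [/\ `|phi s| <= `|phi m|, `|u s| <= cu,
    del `|u s| <= del cu & expR (w * (s - t0)) <= expR (w * (t - t0))].
  move=> /andP[s1 s2]; have hus := hu s (le_trans t00 s1); split=> //.
  - by apply: hm; rewrite in_itv /= s1.
  - by apply: (class_K_le delK).
  - by rewrite ler_expR ler_wpM2l ?(ltW w0) // lerB.
pose Y := fun s => expR (w * (s - t0)) * `|phi s|.
pose G := fun s => k * g * del `|u s|.
pose F := fun s => k * b * expR (w * (s - t0)) * `|u s|.
have kg0 : 0 < k * g by rewrite mulr_gt0.
have kb0 : 0 < k * b by rewrite mulr_gt0.
have G0 s : 0 <= G s by rewrite mulr_ge0 ?del0 // ltW.
have Y0 s : 0 <= Y s by rewrite mulr_ge0 ?expR_ge0.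
have F0 s : 0 <= F s by rewrite !mulr_ge0 ?expR_ge0 // ltW.
have mY : measurable_fun `[t0, t] Y by exact: measurable_funM.
have mG : measurable_fun `[t0, t] G by apply: measurable_funM.
have mF : measurable_fun `[t0, t] F.
  by apply: measurable_funM => //; apply: measurable_funM.
pose NY := expR (w * (t - t0)) * `|phi m|.
pose NG := k * g * del cu.
pose NF := k * b * expR (w * (t - t0)) * cu.
have hY s : t0 <= s <= t -> 0 <= Y s <= NY.
  by move=> hs; rewrite Y0 /=; have [h1 h2 h3 h4] := bnd s hs; apply: ler_pM; rewrite ?expR_ge0.
have hG s : t0 <= s <= t -> 0 <= G s <= NG.
  by move=> hs; rewrite G0 /=; have [h1 h2 h3 h4] := bnd s hs; rewrite ler_wpM2l // ltW.
have hF s : t0 <= s <= t -> 0 <= F s <= NF.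
  move=> hs; rewrite F0 /=; have [h1 h2 h3 h4] := bnd s hs.
  apply: ler_pM => //; first by rewrite mulr_ge0 ?expR_ge0 // ltW.
  by rewrite ler_wpM2l // ltW.
have int (f : R -> R) (N : R) s : measurable_fun `[t0, t] f ->
    (forall s, t0 <= s <= t -> 0 <= f s <= N) -> s <= t ->
    mu.-integrable `[t0, s] (EFin \o f).
  move=> mf hf st; apply: (@integrableS _ _ _ mu `[t0, t]) => //.
    by apply: subset_itvl; rewrite bnd_simp.
  by apply: (bounded_integrable (N := N)) => // r /hf/andP[h1 h2]; rewrite ger0_norm.
have iu s : s <= t -> mu.-integrable `[t0, s] (EFin \o (fun s => `|u s|)).
  by apply: (int _ cu) => // r hr; rewrite normr_ge0 /=; have [] := bnd r hr.
have id s : s <= t -> mu.-integrable `[t0, s] (EFin \o (fun s => del `|u s|)).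
  by apply: (int _ (del cu)) => // r hr; rewrite del0 /=; have [] := bnd r hr.
have iF s : s <= t -> mu.-integrable `[t0, s] (EFin \o F) by exact: (int _ NF).
have iGY s : s <= t -> mu.-integrable `[t0, s] (EFin \o (fun s => G s * Y s)).
  apply: (int _ (NG * NY)); first exact: measurable_funM.
  move=> r hr; have /andP[h1 h2] := hG r hr; have /andP[h3 h4] := hY r hr.
  by rewrite mulr_ge0 //= ler_pM.
pose E1 := \int[mu]_(s in `[t0, t]) `|u s|.
(* [gronwall] needs [A] independent of the running time, so the weight in the input term is frozen
   at its final value; it cancels when the estimate is multiplied by e^{-w(t - t0)}. *)
pose A := k * `|x0| + k * b * expR (w * (t - t0)) * E1.
have E10 : 0 <= E1 by apply: Rintegral_ge0.
have A0 : 0 <= A.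
  apply: addr_ge0; first by rewrite mulr_ge0 // ltW.
  by apply: mulr_ge0 => //; rewrite mulr_ge0 ?expR_ge0 // ltW.
have key s : t0 <= s <= t -> Y s <= A + \int[mu]_(r in `[t0, s]) (G r * Y r).
  move=> /andP[ts st].
  have es : 0 < expR (- w * (s - t0)) by exact: expR_gt0.
  have ess : expR (w * (s - t0)) * expR (- w * (s - t0)) = 1.
    by rewrite mulNr expRN mulfV // gt_eqF // expR_gt0.
  have HI := sphi s ts (ltry s).
  have iH : mu.-integrable `[t0, s] (EFin \o (fun r => F r + G r * Y r)).
    rewrite (_ : EFin \o _ = ((EFin \o F) \+ (EFin \o (fun s => (G s * Y s)%R)))%E).
      by apply: integrableD => //; [exact: iF|exact: iGY].
    by apply/funext => r /=; rewrite EFinD.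
  have iH' : mu.-integrable `[t0, s]
      (EFin \o (fun r => expR (- w * (s - t0)) * (F r + G r * Y r))).
    rewrite (_ : EFin \o _ = fun r => ((expR (- w * (s - t0)))%:E *
        (EFin \o (fun r => (F r + G r * Y r)%R)) r)%E).
      exact: integrableZl.
    by apply/funext => r /=; rewrite EFinM.
  have hle r : t0 <= r <= s -> `|W s r (Psi r (phi r) (u r))| <=
      expR (- w * (s - t0)) * (F r + G r * Y r).
    move=> /andP[tr rs]; have r0 := le_trans t00 tr.
    apply: le_trans (W_stab _ _) _; first by rewrite r0.
    have -> : - w * (s - r) = - w * (s - t0) + w * (r - t0) by ring.
    rewrite expRD.
    have -> : expR (- w * (s - t0)) * (F r + G r * Y r) =
      k * (expR (- w * (s - t0)) * expR (w * (r - t0))) *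
      (b * `|u r| + g * `|phi r| * del `|u r|).
      by rewrite /F /G /Y; move: (expR _) (expR _) => ? ?; ring.
    apply: ler_wpM2l; last exact: Psi_growth.
    by rewrite !mulr_ge0 ?expR_ge0 // ltW.
  have := is_RInt_norm_le_Rintegral ts HI iH' hle.
  rewrite RintegralZl // RintegralD //; [|exact: iF|exact: iGY].
  set J1 := \int[mu]_(_ in _) F _; set J2 := \int[mu]_(_ in _) (_ * _).
  move=> hI.
  have hJ1 : J1 <= k * b * expR (w * (t - t0)) * E1.
    rewrite -RintegralZl //; last exact: iu.
    apply: (@le_trans _ _ (\int[mu]_(x in `[t0, s]) (k * b * expR (w * (t - t0)) * `|u x|))).
      apply: le_Rintegral => //; first exact: iF.
        rewrite (_ : EFin \o _ = fun r => ((k * b * expR (w * (t - t0)))%:E *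
          (EFin \o (fun r => `|u r|%R)) r)%E).
          by apply: integrableZl => //; exact: iu.
        by apply/funext => r /=; rewrite EFinM.
      move=> r; rewrite /= in_itv /= => /andP[r1 r2].
      have [|h1 h2 h3 h4] := bnd r; first by rewrite r1 (le_trans r2).
      by rewrite ler_wpM2r // ler_wpM2l // ltW.
    apply: Rintegral_subitv => //.
      rewrite (_ : EFin \o _ = fun r => ((k * b * expR (w * (t - t0)))%:E *
          (EFin \o (fun r => `|u r|%R)) r)%E).
        by apply: integrableZl => //; exact: iu.
      by apply/funext => r /=; rewrite EFinM.
    by move=> r hr; rewrite !mulr_ge0 ?expR_ge0 // ltW.
  have hW : `|W s t0 x0| <= k * expR (- w * (s - t0)) * `|x0|.
    by apply: W_stab; rewrite t00.
  have hphi : `|phi s| <= expR (- w * (s - t0)) * (k * `|x0| + (J1 + J2)).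
    rewrite -[phi s](subrK (W s t0 x0)); apply: le_trans (ler_normD _ _) _.
    rewrite mulrDr addrC; apply: lerD => //.
    by rewrite mulrCA mulrA.
  rewrite /Y; apply: (@le_trans _ _ (expR (w * (s - t0)) *
     (expR (- w * (s - t0)) * (k * `|x0| + (J1 + J2))))).
    by rewrite ler_wpM2l ?expR_ge0.
  by rewrite mulrA ess mul1r /A addrA lerD2r lerD2l.
have := gronwall t0t A0 mY mG hY hG key.
rewrite RintegralZl //; last exact: id.
set E2 := \int[mu]_(_ in _) del _ => hfin.
have E20 : 0 <= E2 by apply: Rintegral_ge0.
rewrite RintegralD //; [|exact: iu|exact: id].
rewrite -/E1 -/E2.
have ett : expR (- w * (t - t0)) * expR (w * (t - t0)) = 1.
  by rewrite mulNr expRN mulVf // gt_eqF // expR_gt0.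
have -> : `|phi t| = expR (- w * (t - t0)) * Y t by rewrite /Y mulrA ett mul1r.
apply: (@le_trans _ _ (expR (- w * (t - t0)) * (A * expR (2 * (k * g * E2))))).
  by rewrite ler_wpM2l ?expR_ge0.
have -> : expR (- w * (t - t0)) * (A * expR (2 * (k * g * E2))) =
    (k * expR (- w * (t - t0)) * `|x0| + k * b * E1) * expR (2 * (k * g * E2)).
  rewrite mulrA; congr (_ * _).
  rewrite /A mulrDr; congr (_ + _); first by rewrite mulrCA mulrA.
  have -> : expR (- w * (t - t0)) * (k * b * expR (w * (t - t0)) * E1) =
    expR (- w * (t - t0)) * expR (w * (t - t0)) * (k * b * E1).
    by move: (expR _) (expR _) => ? ?; ring.
  by rewrite ett mul1r.
(* Both energies are enlarged to their sum, because the iISS estimate has a single [mu]. *)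
apply: ler_pM; rewrite ?expR_ge0 //.
- apply: addr_ge0; first by rewrite !mulr_ge0 ?expR_ge0 // ltW.
  by apply: mulr_ge0 => //; exact: ltW.
- by rewrite lerD2l ler_wpM2l ?(ltW kb0) // lerDl.
- by rewrite ler_expR -[leRHS]mulrA ler_wpM2l // ler_wpM2l ?(ltW kg0) // lerDr.
Qed.

End InputToState.

(** The upper bound on V gives the decay term. The lower bound gives x^2 <= V/c1, so K (1 + V)
    dominates x^2, and also x because x <= 1 + x^2; dividing by 1 + V then removes x from the input
    terms. *)
Lemma dissipation_le {R : realType} (c1 c2 K q V x p v d : R) :
  0 < c1 -> 0 < c2 -> 0 <= q -> 0 <= x -> 0 <= v -> 0 <= d -> K = 1 + c1^-1 ->
  c1 * x ^+ 2 <= V -> V <= c2 * x ^+ 2 -> p <= v + x * d ->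
  (- x ^+ 2 + q * x * p) / (1 + V) <= - (x ^+ 2 / (1 + c2 * x ^+ 2)) + q * K * (v + d).
Proof.
move=> c10 c20 q0 x0 v0 d0 -> hV1 hV2 hp.
have xx0 : 0 <= x ^+ 2 by exact: sqr_ge0.
have V0 : 0 <= V by apply: le_trans hV1; rewrite mulr_ge0 // ltW.
have V1 : 0 < 1 + V by rewrite ltr_wpDr.
have W1 : 0 < 1 + c2 * x ^+ 2 by rewrite ltr_wpDr // mulr_ge0 // ltW.
have ic : 0 < c1^-1 by rewrite invr_gt0.
have hx2 : x ^+ 2 <= (1 + c1^-1) * (1 + V).
  apply: (@le_trans _ _ (c1^-1 * V)); first by rewrite -ler_pdivrMl ?invrK.
  apply: ler_pM => //; rewrite ?(ltW ic) ?lerDr //.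
have hx : x <= (1 + c1^-1) * (1 + V).
  have h1 : x <= 1 + x ^+ 2 by have := sqr_ge0 (x - 1); rewrite sqrrB1; lra.
  apply: le_trans h1 _.
  have h2 : x ^+ 2 <= c1^-1 * V by rewrite -ler_pdivrMl ?invrK.
  rewrite mulrDl mul1r mulrDr mulr1.
  by move: h2 V0 (ltW ic); move: (c1^-1 * V) (c1^-1) => ? ? ? ? ?; lra.
rewrite mulrDl; apply: lerD.
  rewrite mulNr lerN2 ler_wpM2l // lef_pV2 ?posrE //.
  by rewrite lerD2l.
rewrite ler_pdivrMr // -!mulrA ler_wpM2l // mulrA.
apply: (@le_trans _ _ (x * v + x ^+ 2 * d)).
  have := ler_wpM2l x0 hp; have -> : x * (v + x * d) = x * v + x ^+ 2 * d by ring.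
  by [].
have -> : (1 + c1^-1) * (v + d) * (1 + V) =
  (1 + c1^-1) * (1 + V) * v + (1 + c1^-1) * (1 + V) * d by ring.
by apply: lerD; rewrite ler_wpM2r.
Qed.

Theorem mainTheorem13 (R : realType) (X U : completeNormedModType R)
  (DA : R -> set X) (A : R -> X -> X) (W : R -> R -> {linear X -> X})
  (B : R -> {linear U -> X}) (psi : R -> X -> U -> X) :
  evolution_family_gen DA A W ->
  (* B in C(R_+, L(U,X)) with sup_t ||B(t)|| < oo *)
  (forall t : R, 0 <= t -> forall e : R, 0 < e -> exists d : R, 0 < d /\
     forall s : R, 0 <= s -> `|s - t| < d -> forall v : U, `|B s v - B t v| <= e * `|v|) ->
  (exists b : R, forall (t : R) (v : U), 0 <= t -> `|B t v| <= b * `|v|) ->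
  H1 (fun t x v => B t v + psi t x v) ->
  (exists (gam : R) (del : R -> R), 0 < gam /\ class_K del /\
     forall (t : R) (x : X) (v : U), 0 <= t -> `|psi t x v| <= gam * `|x| * del `|v|) ->
  (exists k w : R, 0 < k /\ 0 < w /\
     forall (t s : R) (x : X), 0 <= s <= t -> `|W t s x| <= k * expR (- w * (t - s)) * `|x|) ->
  (exists M lam : R, 0 < M /\ 0 < lam /\
     forall (t s : R) (x : X), 0 <= s <= t -> M * expR (- lam * (t - s)) * `|x| <= `|W t s x|) ->
  coercive_iISS_LF W (fun t x v => B t v + psi t x v) (fun t x => ln (1 + Vfun W t x)) /\
  iISS W (fun t x v => B t v + psi t x v).
Proof.
move=> [_ [_ [W_id [W_comp [W_cont _]]]]] _ [b' hB] PsiH1 [gam [del [gam0 [delK hpsi]]]].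
move=> [k [w [k0 [w0 W_stab]]]] [M [lam [M0 [lam0 W_low]]]].
set Psi := fun t x v => B t v + psi t x v in PsiH1 *.
pose b := `|b'| + 1.
have b0 : 0 < b by rewrite ltr_wpDl.
have growth s y v : 0 <= s -> `|Psi s y v| <= b * `|v| + gam * `|y| * del `|v|.
  move=> s0; apply: le_trans (ler_normD _ _) _; apply: lerD; last exact: hpsi.
  apply: le_trans (hB _ _ s0) _; rewrite ler_wpM2r //.
  by apply: le_trans (ler_norm b') _; rewrite lerDl.
pose c2 := vcst k w.
have c20 : 0 < c2 by exact: vcst_gt0.
pose c1 := M ^+ 2 / (2 * lam).
have c10 : 0 < c1 by rewrite divr_gt0 ?exprn_gt0 ?mulr_gt0.
have V_ub := Vfun_ub W_cont k0 w0 W_stab.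
have V_lb := Vfun_lb W_cont k0 w0 W_stab M0 lam0 W_low.
have V_ge0 := @Vfun_ge0 R X W.
have V1 t x : 0 < 1 + Vfun W t x by rewrite ltr_wpDr.
split; first split; [|split; [|split]|split].
- apply/subspace_continuousP => -[t x] /= t0.
  have /subspace_continuousP h := @Vfun_continuous R X W k w W_id W_comp W_cont k0 w0 W_stab.
  have h1 : 1 + Vfun W q.1 q.2 @[q --> within [set q : R * X | 0 <= q.1] (nbhs (t, x))]
      --> 1 + Vfun W t x.
    by apply: cvgD; [exact: cvg_cst|exact: (h (t, x) t0)].
  exact: cvg_comp h1 (continuous_ln (V1 t x)).
- move=> t t0; have := V_ub 0 t t0; rewrite normr0 expr0n mulr0 => h.
  by have -> : Vfun W t 0 = 0; [apply/le_anti; rewrite h V_ge0|rewrite addr0 ln1].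
- exists (fun r => ln (1 + c1 * r ^+ 2)), (fun r => ln (1 + c2 * r ^+ 2)).
  split; first exact: class_Kinf_ln.
  split; first exact: class_Kinf_ln.
  have pos c r : 0 < c -> 0 < 1 + c * r ^+ 2 :> R.
    by move=> c0; rewrite ltr_wpDr // mulr_ge0 ?sqr_ge0 // ltW.
  move=> t x t0; rewrite !ler_ln ?posrE ?V1 ?pos //.
  by rewrite !lerD2l V_lb ?V_ub.
- pose K := 1 + c1^-1.
  have K0 : 0 < K by rewrite ltr_wpDr // invr_ge0 ltW.
  pose q := 2 * c2 * k ^+ 2.
  have q0 : 0 < q by rewrite mulr_gt0 ?exprn_gt0 // mulr_gt0.
  have qK : 0 < q * K by exact: mulr_gt0.
  (* The pair produced by [dissipation_le], with [q] the coefficient of the cross term in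
     [lie_deriv_le], v = b |u| and d = gam del(|u|). *)
  exists (fun r => r ^+ 2 / (1 + c2 * r ^+ 2)), (fun r => q * K * b * r + q * K * gam * del r).
  split; first exact: pos_def_ratio.
  split; first by apply: class_K_comb => //; [exact: mulr_gt0|apply/ltW; exact: mulr_gt0].
  move=> t x u T phi t0 tT uPC sol.
  apply: le_trans (lie_deriv_le W_id W_comp W_cont k0 w0 W_stab PsiH1 t0 tT uPC sol) _.
  rewrite lee_fin.
  have -> : q * K * b * `|u t| + q * K * gam * del `|u t| =
    q * K * (b * `|u t| + gam * del `|u t|) by ring.
  apply: (dissipation_le c10 c20 (ltW q0)) => //.
  + by rewrite mulr_ge0 // ltW.
  + by rewrite mulr_ge0 ?(ltW gam0) // (class_K_ge0 delK).
  + exact: V_lb.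
  + exact: V_ub.
  + apply: le_trans (growth _ _ _ t0) _; rewrite lerD2l.
    by rewrite [gam * `|x|]mulrC -mulrA.
- move=> t0 x0 u t00 uPC.
  have [[cu hu] _] := uPC.
  (* Along one bounded input the bilinear growth is linear in the state; the [+ 1] makes the
     coefficient positive even for the zero input. *)
  pose P := b * `|cu| + gam * del `|cu| + 1.
  have d0 := class_K_ge0 delK (normr_ge0 cu).
  have bc0 : 0 <= b * `|cu| by rewrite mulr_ge0 // ltW.
  have gc0 : 0 <= gam * del `|cu| by rewrite mulr_ge0 // ltW.
  have P0 : 0 < P by rewrite ltr_wpDl // addr_ge0.
  have Pg s y : 0 <= s -> `|Psi s y (u s)| <= P * (1 + `|y|).
    move=> s0; apply: le_trans (growth _ _ _ s0) _.
    have hus : `|u s| <= `|cu| by exact: le_trans (hu s s0) (ler_norm _).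
    have h1 : b * `|u s| <= b * `|cu| by rewrite ler_wpM2l // ltW.
    have h2 : gam * `|y| * del `|u s| <= gam * del `|cu| * `|y|.
      rewrite mulrAC ler_wpM2r // ler_wpM2l ?(ltW gam0) //.
      exact: (class_K_le delK).
    apply: le_trans (lerD h1 h2) _; rewrite mulrDr mulr1 /P.
    apply: lerD; first by rewrite -addrA lerDl addr_ge0.
    by rewrite ler_wpM2r // -addrA addrCA lerDl addr_ge0.
  exists (picard_lim W Psi t0 x0 u).
  exact: (picard_lim_mild_sol W_comp W_cont k0 w0 W_stab PsiH1 x0 t00 uPC P0 Pg).
(* The two halves of [split_product] for a = k e^{-w(t - t0)} |x0|, E = 2 k gam r and B = k b r,
   where [r] is the integral of |u| + del(|u|). *)
- exists (fun r => (expR (2 * (k * gam) * r) - 1) ^+ 2 / 2 +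
      k * b * r * expR (2 * (k * gam) * r)), (fun r => 1 * r + 1 * del r),
    (fun r t => k * expR (- w * (t - 0)) * r + (k * expR (- w * (t - 0)) * r) ^+ 2 / 2).
  have kg0 : 0 < 2 * (k * gam) by rewrite !mulr_gt0.
  split; first by apply: class_Kinf_exp => //; exact: mulr_gt0.
  split; first exact: class_K_comb.
  split; first exact: class_KL_exp.
  move=> t0 x0 u phi t00 uPC sol t t0t; rewrite subr0.
  have -> : (fun s => 1 * `|u s| + 1 * del `|u s|) = (fun s => `|u s| + del `|u s|).
    by apply/funext => s; rewrite !mul1r.
  apply: le_trans (iISS_estimate k0 w0 W_stab b0 gam0 delK growth t00 uPC sol t0t) _.
  apply: split_product.
  by rewrite mulr_ge0 // mulr_ge0 ?expR_ge0 // ltW.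
Qed.
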